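(* Let $\ell$ be a positive integer. Let $X_1,\dots,X_\ell$ be subvarieties of $\mathbb{P}^n$ of dimensions $r_1,\dots,r_\ell$ whose linear spans are generic of dimensions $h_1,\dots,h_\ell$, respectively. If $n\geq (h_1+1)\cdots(h_\ell+1)-1$, then: \begin{enumerate} \item[i)] $\dim(X_1\star\cdots\star X_\ell)=\sum_{i=1}^{\ell}\dim(X_i)$; \item[ii)] $\deg(X_1\star\cdots\star X_\ell)=\binom{r_1+\cdots+r_\ell}{r_1,\dots,r_\ell}\prod_{i=1}^{\ell}\deg(X_i)$, where $\binom{r_1+\cdots+r_\ell}{r_1,\dots,r_\ell}=\frac{(r_1+\cdots+r_\ell)!}{r_1!\cdots r_\ell!}$; \item[iii)] $HF_{X_1\star\cdots\star X_\ell}=\prod_{i=1}^{\ell}HF_{X_i}$ (pointwise product of functions). \end{enumerate}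
   Context: The base field $\mathbb{K}$ is algebraically closed of characteristic $0$; all varieties are irreducible (closed subvarieties of projective space). Hadamard product: for subvarieties $X_1,\dots,X_\ell\subseteq\mathbb{P}^n$, $X_1\star\cdots\star X_\ell$ is the Zariski closure in $\mathbb{P}^n$ of the image of the rational map $X_1\times\cdots\times X_\ell\dashrightarrow\mathbb{P}^n$ given by coordinatewise multiplication of homogeneous coordinates (for $\ell=2$: $([a_0:\dots:a_n],[b_0:\dots:b_n])\mapsto[a_0b_0:a_1b_1:\dots:a_nb_n]$). Genericity: ''the linear spans are generic of dimensions $h_1,\dots,h_\ell$'' means that the tuple $(L_1,\dots,L_\ell)$ of linear spans ($L_i$ a linear subspace of $\mathbb{P}^n$ of dimension $h_i$) lies in a suitable nonempty Zariski-open subset, depending only on $n,h_1,\dots,h_\ell$, of the space of all such tuples (parameterized by the coefficients of linear parametric equations of the $L_i$). For tuples in this open set the assertion holds for all subvarieties $X_i$ with linear span $L_i$. Hilbert function: for a subvariety $V\subseteq\mathbb{P}^n$ with saturated radical homogeneous ideal $I_V\subseteq R=\mathbb{K}[x_0,\dots,x_n]=\bigoplus_{t\geq0}R_t$, $HF_V(t)=\dim_{\mathbb{K}}R_t/(I_V)_t$, where $(I_V)_t=I_V\cap R_t$. *)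

(* Defs.v *)
From mathcomp Require Import all_boot all_order all_algebra.
From mathcomp Require Import mpoly.
From mathcomp Require Import boolp classical_sets.

Set Implicit Arguments.
Unset Strict Implicit.
Unset Printing Implicit Defensive.

Import GRing.Theory.
Local Open Scope ring_scope.
Local Open Scope classical_set_scope.

(* A subset of P^n is given by the set of all its homogeneous coordinate
   vectors: nonzero vectors of K^(n+1), a set stable under nonzero scaling
   (closed sets in the sense below always are). *)

Definition proj_zeros (K : fieldType) (n : nat) (S : set {mpoly K[n.+1]}) :
  set 'rV[K]_n.+1 :=
  [set x : 'rV[K]_n.+1 | x != 0 /\ forall p, S p -> p.@[x ord0] = 0].

Definition proj_closed (K : fieldType) (n : nat) (V : set 'rV[K]_n.+1) : Prop :=
  exists S : set {mpoly K[n.+1]},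
    (forall p, S p -> exists d, p \is d.-homog) /\ V = proj_zeros S.

Definition proj_closure (K : fieldType) (n : nat) (A : set 'rV[K]_n.+1) :
  set 'rV[K]_n.+1 :=
  [set x : 'rV[K]_n.+1 | forall V, proj_closed V -> A `<=` V -> V x].

Definition subvariety (K : fieldType) (n : nat) (V : set 'rV[K]_n.+1) : Prop :=
  [/\ proj_closed V, V !=set0 &
      forall A B, proj_closed A -> proj_closed B ->
        V `<=` A `|` B -> V `<=` A \/ V `<=` B].

(* The dimension is the Krull dimension of the underlying topological space. *)
Definition has_chain (K : fieldType) (n : nat) (V : set 'rV[K]_n.+1) (r : nat) :
  Prop :=
  exists Z : nat -> set 'rV[K]_n.+1,
    (forall k, (k <= r)%N -> subvariety (Z k) /\ Z k `<=` V) /\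
    (forall k, (k < r)%N -> Z k `<` Z k.+1).

Definition has_dim (K : fieldType) (n : nat) (V : set 'rV[K]_n.+1) (r : nat) :
  Prop :=
  has_chain V r /\ forall s, has_chain V s -> (s <= r)%N.

Definition vanishing_ideal (K : fieldType) (n : nat) (V : set 'rV[K]_n.+1) :
  set {mpoly K[n.+1]} :=
  [set p : {mpoly K[n.+1]} | forall x, V x -> p.@[x ord0] = 0].

(* The subspace (I_V)_t of R_t; it is selected classically because the type
   {vspace _} only contains detachable subspaces (see mem_ideal_part). *)
Definition ideal_part (K : fieldType) (n : nat) (V : set 'rV[K]_n.+1) (t : nat) :
  {vspace (dhomog n.+1 K t)} :=
  xget 0%VS [set U : {vspace (dhomog n.+1 K t)} |
               forall p, p \in U <-> vanishing_ideal V (val p)].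

Definition hilbert_function (K : fieldType) (n : nat) (V : set 'rV[K]_n.+1)
  (t : nat) : nat :=
  (\dim (fullv : {vspace (dhomog n.+1 K t)}) - \dim (ideal_part V t))%N.

Definition is_hilbert_polynomial (K : fieldType) (n : nat)
  (V : set 'rV[K]_n.+1) (P : {poly rat}) : Prop :=
  exists t0, forall t, (t0 <= t)%N -> P.[t%:R] = (hilbert_function V t)%:R.

(* (dim V)! times the leading coefficient of the Hilbert polynomial of V. *)
Definition has_degree (K : fieldType) (n : nat) (V : set 'rV[K]_n.+1) (d : nat) :
  Prop :=
  exists r P, [/\ has_dim V r, is_hilbert_polynomial V P &
                  d%:R = r`!%:R * lead_coef P].

(* Points y = 0 are discarded: there the rational map is undefined. *)
Definition hadamard_product (K : fieldType) (n l : nat)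
  (X : 'I_l -> set 'rV[K]_n.+1) : set 'rV[K]_n.+1 :=
  proj_closure
    [set y : 'rV[K]_n.+1 | y != 0 /\ exists x : 'I_l -> 'rV[K]_n.+1,
       (forall i, X i (x i)) /\ y = \row_j \prod_(i < l) x i ord0 j].

(* Linear subspaces of P^n of dimension h are vector subspaces of K^(n+1) of
   dimension h + 1. *)
Definition is_linear_span (K : fieldType) (n : nat) (X : set 'rV[K]_n.+1)
  (L : {vspace 'rV[K]_n.+1}) : Prop :=
  (forall x, X x -> x \in L) /\
  (forall M : {vspace 'rV[K]_n.+1}, (forall x, X x -> x \in M) -> (L <= M)%VS).

(* The subspace with parametric equations x = \sum_k s_k (row k A). *)
Definition param_space (K : fieldType) (n m : nat) (A : 'M[K]_(m, n.+1)) :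
  {vspace 'rV[K]_n.+1} :=
  <<[seq row k A | k : 'I_m]>>%VS.

Definition coef_index (n l : nat) (h : 'I_l -> nat) : finType :=
  {i : 'I_l & ('I_(h i).+1 * 'I_n.+1)%type}.

Definition coefs (K : fieldType) (n l : nat) (h : 'I_l -> nat)
  (A : forall i, 'M[K]_((h i).+1, n.+1)) :
  'I_(#|{: coef_index n h}|) -> K :=
  fun k => let c := enum_val k in A (tag c) (tagged c).1 (tagged c).2.

(* Zariski-open sets of tuples of linear subspaces of dimensions h_i, in terms
   of the coefficients of parametric equations of the subspaces. *)
Definition linear_tuples_open (K : fieldType) (n l : nat) (h : 'I_l -> nat)
  (U : set ('I_l -> {vspace 'rV[K]_n.+1})) : Prop :=
  exists S : set {mpoly K[#|{: coef_index n h}|]},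
    forall A : (forall i, 'M[K]_((h i).+1, n.+1)),
      (forall i, row_free (A i)) ->
      (U (fun i => param_space (A i)) <->
       exists2 p, S p & p.@[coefs A] != 0).

Definition for_generic_linear_tuples (K : fieldType) (n l : nat)
  (h : 'I_l -> nat) (P : ('I_l -> {vspace 'rV[K]_n.+1}) -> Prop) : Prop :=
  exists U : set ('I_l -> {vspace 'rV[K]_n.+1}),
    [/\ linear_tuples_open h U,
        exists2 L, U L & forall i, \dim (L i) = (h i).+1 &
        forall L, (forall i, \dim (L i) = (h i).+1) -> U L -> P L].

Definition multinomial_coef (l : nat) (r : 'I_l -> nat) : nat :=
  ((\sum_(i < l) r i)`! %/ \prod_(i < l) (r i)`!)%N.

Lemma mem_ideal_part (K : fieldType) (n : nat) (V : set 'rV[K]_n.+1) (t : nat)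
  (p : dhomog n.+1 K t) : p \in ideal_part V t <-> vanishing_ideal V (val p).
Proof.
move: p; rewrite /ideal_part.
set Q := [set _ | _]; suff: exists U, Q U by move/(xgetPex 0%VS).
pose sub (U : {vspace (dhomog n.+1 K t)}) :=
  forall p, p \in U -> vanishing_ideal V (val p).
pose D := fun d => `[< exists2 U, sub U & \dim U = d >].
have exD : exists d, D d.
  exists 0%N; apply/asboolP; exists 0%VS; last exact: dimv0.
  by move=> p; rewrite memv0 => /eqP -> x _; rewrite !raddf0.
have leD d : D d -> (d <= \dim {: dhomog n.+1 K t})%N.
  by move=> /asboolP[U _ <-]; rewrite dimvS ?subvf.
case: (ex_maxnP exD leD) => d /asboolP[U subU dimU] maxd; exists U => p /=.
split=> [|vp]; first exact: subU.
have subW : sub (U + <[p]>)%VS.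
  move=> q /memv_addP[u /subU uU [w /vlineP[c ->] ->]] x Vx.
  have -> : val (u + c *: p) = val u + c *: val p by [].
  by rewrite mevalD mevalZ uU // vp // mulr0 addr0.
have dW : (\dim (U + <[p]>) <= d)%N.
  by apply: maxd; apply/asboolP; exists (U + <[p]>)%VS.
have /eqP -> : U == (U + <[p]>)%VS by rewrite eqEdim addvSl dimU.
by rewrite (subvP (addvSr _ _)) ?memv_line.
Qed.

(* Main.v *)
Require Import Defs.
From mathcomp Require Import all_boot all_order all_algebra.
From mathcomp Require Import mpoly.
From mathcomp Require Import boolp classical_sets.
From mathcomp Require Import zify.

Set Implicit Arguments.
Unset Strict Implicit.
Unset Printing Implicit Defensive.

Import GRing.Theory.
Local Open Scope ring_scope.
Local Open Scope classical_set_scope.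

(** Let A i be a matrix whose rows span L i. The Hadamard product of the vectors
    x i = s i A i is the row S(s) M, where S(s) is the Segre vector of all the
    products of coordinates of the s i, and the rows of M are the Hadamard
    products of the rows of the A i ([hadamard_rowE]). For general L i the rows
    of M are independent as soon as n + 1 is at least their number, the product
    of the h i + 1 ([general_position_open], [general_position_nonempty]). The
    Hadamard product of the X i is then their Segre product, linearly embedded.

    On the Hilbert function: a form of degree t on P^n induces on the product of
    the X i a combination of products of forms of degree t in each x i, and all
    such products occur because M has a right inverse ([pullback_prod]). Since
    products of independent functions in separate variables are independent
    ([indep_on_fprod]), the space of forms of degree t on the Hadamard product is
    the tensor product of the spaces of forms on the X i
    ([hilbert_function_hadamard]). The Hilbert polynomial, hence its leading
    coefficient, is multiplicative too, which gives the degree once the dimension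
    is known.

    The dimension, a maximal length of chains of subvarieties, is also read off
    from the Hilbert function: a subvariety has dimension r exactly when its
    Hilbert function grows like t^r ([has_dimP]). This growth order is additive
    for products of Hilbert functions, and the Hadamard product is irreducible
    ([hadamard_product_subvariety]), so the dimensions add up.

    In [has_dimP], a chain of length s forces a growth of order at least s,
    because an equation of a smaller subvariety acts injectively on the
    coordinate ring of a larger one ([has_chain_growth]). Conversely a subvariety
    V with growth of order d has a chain of length d ([subvariety_growth]): V is
    projected from points outside of it until the image is a whole projective
    space. Each projection is closed, by resultants ([proj_image_closed]), and
    has finite fibres, so that chains of subvarieties lift ([has_chain_lift]);
    and it changes the Hilbert function by a bounded factor only
    ([hilbert_function_proj]). *)

(** * Spaces of functions and the Hilbert function *)

Section FunctionSpaces.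
Variables (K : fieldType) (T : Type) (V : set T).

Definition indep_on (I : finType) (f : I -> T -> K) :=
  forall c : I -> K, (forall x, V x -> \sum_i c i * f i x = 0) ->
  forall i, c i = 0.

Definition span_on (I : finType) (f : I -> T -> K) (g : T -> K) :=
  exists c : I -> K, forall x, V x -> g x = \sum_i c i * f i x.

Lemma indep_leq_span (I J : finType) (f : I -> T -> K) (g : J -> T -> K) :
  indep_on f -> (forall i, span_on g (f i)) -> (#|I| <= #|J|)%N.
Proof.
move=> fI /choice[C fC]; rewrite leqNgt; apply/negP => ltJI.
pose M := \matrix_(i < #|I|, j < #|J|) C (enum_val i) (enum_val j).
have [u uM0 u_neq0] : exists2 u : 'rV_#|I|, u *m M = 0 & u != 0.
  have /rowV0Pn[u /sub_kermxP uM u0] : kermx M != 0.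
    rewrite -mxrank_eq0 mxrank_ker subn_eq0 -ltnNge.
    exact: leq_ltn_trans (rank_leq_col M) ltJI.
  by exists u.
case/negP: u_neq0; apply/eqP/rowP => i; rewrite mxE -(enum_valK i).
apply: (fI (fun k => u 0 (enum_rank k))) => x Vx.
under eq_bigr => k _ do rewrite (fC k x Vx) mulr_sumr.
rewrite exchange_big /= big1 // => j _.
have := congr1 (fun w : 'rV_ _ => w 0 (enum_rank j)) uM0; rewrite !mxE => uj.
transitivity ((\sum_k u 0 k * M k (enum_rank j)) * g j x); last first.
  by rewrite uj mul0r.
rewrite big_distrl /=.
rewrite (reindex_onto (@enum_val I predT) (@enum_rank I)) /=; last first.
  by move=> k _; rewrite enum_rankK.
apply: eq_big => k; first by rewrite enum_valK eqxx.
by rewrite mxE enum_valK enum_rankK mulrA.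
Qed.

End FunctionSpaces.

Section Hilbert.
Variables (K : fieldType) (n : nat).
Implicit Types (V : set 'rV[K]_n.+1) (p : {mpoly K[n.+1]}).

(** The Hilbert function is the size of a basis of the space of functions that
    the forms of degree t induce on V; all later computations exhibit such
    bases. *)
Lemma hilbert_basis V t :
  exists b : 'I_(hilbert_function V t) -> {mpoly K[n.+1]},
  [/\ forall k, b k \is t.-homog,
      indep_on V (fun k x => (b k).@[x ord0])
    & forall p, p \is t.-homog ->
        span_on V (fun k x => (b k).@[x ord0]) (fun x => p.@[x ord0])].
Proof.
pose W := ((ideal_part V t)^C)%VS.
have dW : \dim W = hilbert_function V t by rewrite dimv_compl.
rewrite -dW; pose b := vbasis W.
have bW : basis_of W b := vbasisP W.
exists (fun k => val b`_k); split=> [k|c c0 k|p hp].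
- exact: dhomog_is_dhomog.
- have sW : \sum_(i < \dim W) c i *: b`_i \in W.
    apply: memv_suml => i _; apply: memvZ; apply: (basis_mem bW).
    by rewrite mem_nth // size_tuple.
  have sI : \sum_(i < \dim W) c i *: b`_i \in ideal_part V t.
    apply/mem_ideal_part => x Vx /=; rewrite raddf_sum /= raddf_sum /=.
    rewrite -[RHS](c0 x Vx); apply: eq_bigr => i _.
    by rewrite -mevalZ.
  have : \sum_(i < \dim W) c i *: b`_i \in (ideal_part V t :&: W)%VS.
    by rewrite memv_cap sI sW.
  rewrite capv_compl memv0 => /eqP s0.
  by move/freeP: (basis_free bW) => fb; exact: (fb c s0 k).
- have : DHomog hp \in (ideal_part V t + W)%VS by rewrite addv_complf memvf.
  case/memv_addP => u uI [w wW] eqp.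
  rewrite (coord_basis bW wW) in eqp.
  exists (fun i => coord b i w) => x Vx.
  have -> : p = val u + \sum_(i < \dim W) coord b i w *: val b`_i.
    by rewrite -[p]/(val (DHomog hp)) eqp /= raddf_sum.
  rewrite mevalD (mem_ideal_part V u).1 // add0r raddf_sum /=.
  by apply: eq_bigr => i _; rewrite mevalZ.
Qed.

Lemma hilbert_function_geq V t (I : finType) (b : I -> {mpoly K[n.+1]}) :
  (forall i, b i \is t.-homog) -> indep_on V (fun i x => (b i).@[x ord0]) ->
  (#|I| <= hilbert_function V t)%N.
Proof.
move=> hb bI; have [e [_ _ es]] := hilbert_basis V t.
rewrite -[X in (_ <= X)%N]card_ord.
by apply: (indep_leq_span bI) => i; apply: es.
Qed.

Lemma hilbert_function_leq V t (J : finType) (g : J -> 'rV[K]_n.+1 -> K) :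
  (forall p, p \is t.-homog -> span_on V g (fun x => p.@[x ord0])) ->
  (hilbert_function V t <= #|J|)%N.
Proof.
move=> gs; have [e [he ei _]] := hilbert_basis V t.
rewrite -[X in (X <= _)%N]card_ord.
by apply: (indep_leq_span ei) => i; apply: gs.
Qed.

Lemma hilbert_function_eq V t (I : finType) (b : I -> {mpoly K[n.+1]}) :
  (forall i, b i \is t.-homog) -> indep_on V (fun i x => (b i).@[x ord0]) ->
  (forall p, p \is t.-homog ->
     span_on V (fun i x => (b i).@[x ord0]) (fun x => p.@[x ord0])) ->
  hilbert_function V t = #|I|.
Proof.
move=> hb bI bs; apply/eqP.
by rewrite eqn_leq (hilbert_function_leq bs) (hilbert_function_geq hb bI).
Qed.

Lemma hilbert_function_sub V W t : V `<=` W ->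
  (hilbert_function V t <= hilbert_function W t)%N.
Proof.
move=> sVW; have [b [_ _ bs]] := hilbert_basis W t.
rewrite -[X in (_ <= X)%N]card_ord; apply: hilbert_function_leq => p /bs[c cp].
by exists c => x /sVW/cp; apply.
Qed.

Lemma hilbert_function_gt0 V : V !=set0 -> V `<=` [set x | x != 0] ->
  forall t, (0 < hilbert_function V t)%N.
Proof.
move=> [x Vx] /(_ x Vx)/= x0 t.
have [j xj] : exists j, x ord0 j != 0 by apply/rV0Pn.
rewrite -card_unit; apply: (@hilbert_function_geq _ _ _ (fun=> 'X_j ^+ t)) => [_|c].
  rewrite -{2}[t]mul1n; apply: (@dhomogMn _ _ mdeg).
  by rewrite dhomogX /= mdeg1.
move/(_ x Vx) => /eqP; rewrite (big_pred1 tt) => [|[]//].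
rewrite rmorphXn /= mevalXU mulf_eq0 expf_eq0 (negPf xj) andbF orbF.
by move=> /eqP c0 [].
Qed.

End Hilbert.

(** * Homogeneous polynomials and closed sets *)

Section Cones.
Variables (K : fieldType) (n : nat).
Implicit Types (V A B : set 'rV[K]_n.+1) (p f g : {mpoly K[n.+1]}).

Lemma meval_homogZ m d (p : {mpoly K[m]}) c (x : 'rV[K]_m) : p \is d.-homog ->
  p.@[(c *: x) ord0] = c ^+ d * p.@[x ord0].
Proof.
move=> /dhomogP hp; rewrite !mevalE big_distrr /=.
apply: eq_big_seq => e /hp <-.
under eq_bigr => i _ do rewrite mxE exprMn.
by rewrite big_split /= prodrXr mdegE mulrCA.
Qed.

Lemma proj_closed_neq0 V x : proj_closed V -> V x -> x != 0.
Proof. by move=> [S [_ ->]] []. Qed.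

Lemma proj_closedZ V c x : proj_closed V -> c != 0 -> V x -> V (c *: x).
Proof.
move=> [S [hS ->]] c0 [x0 Sx]; split; first by rewrite scaler_eq0 negb_or c0.
move=> p Sp; have [d hp] := hS _ Sp.
by rewrite (meval_homogZ _ _ hp) Sx // mulr0.
Qed.

Lemma proj_closed_sep V x : proj_closed V -> x != 0 -> ~ V x ->
  exists d f, [/\ f \is d.-homog, forall y, V y -> f.@[y ord0] = 0
                & f.@[x ord0] != 0].
Proof.
move=> [S [hS ->]] x0 /not_andP[//|/existsNP[f /not_implyP[Sf /eqP fx]]].
by have [d hf] := hS _ Sf; exists d, f; split=> // y [_]; apply.
Qed.

Lemma proj_closedI V W : proj_closed V -> proj_closed W -> proj_closed (V `&` W).
Proof.
move=> [S [hS ->]] [S' [hS' ->]]; exists (S `|` S'); split.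
  by move=> p []; [apply: hS|apply: hS'].
apply/seteqP; split=> x /=.
  by move=> [[x0 h] [_ h']]; split=> // p []; [apply: h|apply: h'].
by move=> [x0 h]; split; split=> // p Sp; apply: h; [left|right].
Qed.

Lemma proj_closed_zeros d f : f \is d.-homog ->
  proj_closed [set x : 'rV[K]_n.+1 | x != 0 /\ f.@[x ord0] = 0].
Proof.
move=> hf; exists [set f]; split=> [p ->|]; first by exists d.
apply/seteqP; split=> x /= [x0 h]; split=> //; first by move=> p ->.
exact: h.
Qed.

Lemma proj_closed_closure A : A `<=` [set x | x != 0] ->
  proj_closed (proj_closure A).
Proof.
move=> A0; pose S := [set p | (exists d, p \is d.-homog) /\
  forall x, A x -> p.@[x ord0] = 0].
exists S; split=> [p []//|]; apply/seteqP; split=> x.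
  move=> /(_ (proj_zeros S)); apply.
    by exists S; split=> // p [].
  by move=> y Ay; split; [exact: A0|move=> p [_]; apply].
move=> [x0 Sx] V clV AV; apply: contrapT => /(proj_closed_sep clV x0).
move=> [d [f [hf fV /eqP]]]; apply; apply: Sx; split; first by exists d.
by move=> y /AV/fV.
Qed.

Lemma sub_proj_closure A : A `<=` proj_closure A.
Proof. by move=> x Ax V _; apply. Qed.

Lemma vanish_closure A d p : A `<=` [set x | x != 0] -> p \is d.-homog ->
  (forall x, A x -> p.@[x ord0] = 0) ->
  forall x, proj_closure A x -> p.@[x ord0] = 0.
Proof.
move=> A0 hp pA x /(_ _ (proj_closed_zeros hp)).
by case=> [y Ay|//]; split; [exact: A0|exact: pA].
Qed.

(** Irreducibility in terms of equations: the homogeneous ideal of V is prime. *)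
Lemma subvariety_prime V d e f g : subvariety V ->
  f \is d.-homog -> g \is e.-homog ->
  (exists2 x, V x & f.@[x ord0] != 0) -> (exists2 x, V x & g.@[x ord0] != 0) ->
  exists x, [/\ V x, f.@[x ord0] != 0 & g.@[x ord0] != 0].
Proof.
move=> [clV _ irrV] hf hg [x Vx fx] [y Vy gy]; apply: contrapT => nfg.
have [z Vz||] := irrV _ _ (proj_closed_zeros hf) (proj_closed_zeros hg).
- have z0 := proj_closed_neq0 clV Vz.
  have [fz|fz] := eqVneq f.@[z ord0] 0; first by left.
  have [gz|gz] := eqVneq g.@[z ord0] 0; first by right.
  by case: nfg; exists z.
- by move=> /(_ x Vx)[_ /eqP]; rewrite (negPf fx).
- by move=> /(_ y Vy)[_ /eqP]; rewrite (negPf gy).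
Qed.

Lemma subvariety_mulf_eq0 V d e f g : subvariety V ->
  f \is d.-homog -> g \is e.-homog -> (exists2 x, V x & f.@[x ord0] != 0) ->
  (forall x, V x -> f.@[x ord0] * g.@[x ord0] = 0) ->
  forall x, V x -> g.@[x ord0] = 0.
Proof.
move=> sV hf hg fV fg0 x Vx; apply/eqP; apply: contraT => gx.
have [|z [Vz fz gz]] := subvariety_prime sV hf hg fV; first by exists x.
by have /eqP := fg0 z Vz; rewrite mulf_eq0 (negPf fz) (negPf gz).
Qed.

Lemma prime_subvariety V : proj_closed V -> V !=set0 ->
  (forall d e f g, f \is d.-homog -> g \is e.-homog ->
    (exists2 x, V x & f.@[x ord0] != 0) ->
    (exists2 x, V x & g.@[x ord0] != 0) ->
    exists x, [/\ V x, f.@[x ord0] != 0 & g.@[x ord0] != 0]) ->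
  subvariety V.
Proof.
move=> clV V0 pV; split=> // A B clA clB VAB.
apply: contrapT => /not_orP[/existsNP[x /not_implyP[Vx Ax]]].
move=> /existsNP[y /not_implyP[Vy By]].
have [d [f [hf fA fx]]] := proj_closed_sep clA (proj_closed_neq0 clV Vx) Ax.
have [e [g [hg gB gy]]] := proj_closed_sep clB (proj_closed_neq0 clV Vy) By.
have [||z [Vz /eqP fz /eqP gz]] := pV _ _ _ _ hf hg; [by exists x|by exists y|].
by case: (VAB z Vz) => [/fA|/gB].
Qed.

End Cones.

(** The homogeneous components of a polynomial D vanishing on a cone vanish there
    too: they are the coefficients of D(c x) as a polynomial in c, which is zero
    at infinitely many scalars c. *)
Lemma cone_separation (K : closedFieldType) n (A : set 'rV[K]_n.+1)
    (D : {mpoly K[n.+1]}) (y : 'rV[K]_n.+1) :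
  (forall c x, c != 0 -> A x -> A (c *: x)) ->
  (forall x, A x -> D.@[x ord0] = 0) -> D.@[y ord0] != 0 ->
  exists d f, [/\ f \is d.-homog, forall x, A x -> f.@[x ord0] = 0
                & f.@[y ord0] != 0].
Proof.
move=> AZ DA Dy; pose k := msize D.
have DE z : D.@[z ord0] = \sum_(d < k) (pihomog mdeg d D).@[z ord0].
  by rewrite {1}(pihomog_partitionE (leqnn _ : (msize D <= k)%N)) raddf_sum.
have [d Dd] : exists d : 'I_k, (pihomog mdeg d D).@[y ord0] != 0.
  apply: contrapT => /forallNP D0; case/eqP: Dy; rewrite DE big1 // => d _.
  by apply/eqP/negPn/negP/D0.
exists (nat_of_ord d), (pihomog mdeg d D); split=> //; first exact: pihomogP.
move=> x Ax; pose Q := \poly_(i < k) (pihomog mdeg i D).@[x ord0].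
suff Q0 : Q = 0.
  by have := coef_poly k (fun i => (pihomog mdeg i D).@[x ord0]) d;
     rewrite -/Q Q0 coef0 ltn_ord.
apply/eqP; apply: contraT => nQ.
have /closed_nonrootP[c] : Q * 'X != 0 by rewrite mulf_neq0 ?polyX_eq0.
rewrite rootM negb_or {2}/root hornerX => /andP[/eqP Qc c0].
case: Qc; rewrite horner_poly -[RHS](DA (c *: x)); last exact: AZ.
rewrite DE; apply: eq_bigr => i _.
by rewrite (meval_homogZ _ _ (pihomogP mdeg _ _)) mulrC.
Qed.

(** * Chains and the growth of the Hilbert function *)

Section Growth.
Variables (K : fieldType) (n : nat).
Implicit Types (V Z : set 'rV[K]_n.+1).

(** Multiplication by f embeds the forms on V of degree t into those of degree
    t + e, and its image vanishes on Z, whereas the latter restrict onto the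
    forms on Z. *)
Lemma hilbert_function_section V Z e f t : subvariety V -> Z `<=` V ->
  f \is e.-homog -> (forall x, Z x -> f.@[x ord0] = 0) ->
  (exists2 x, V x & f.@[x ord0] != 0) ->
  (hilbert_function V t + hilbert_function Z (t + e) <=
   hilbert_function V (t + e))%N.
Proof.
move=> sV ZV hf fZ fV.
have [b [hb bI _]] := hilbert_basis V t.
have [b' [hb' bI' _]] := hilbert_basis Z (t + e).
rewrite -[X in (X + _)%N]card_ord -[X in (_ + X)%N]card_ord -card_sum.
pose g (s : 'I_(hilbert_function V t) + 'I_(hilbert_function Z (t + e))) :=
  match s with inl i => b i * f | inr j => b' j end.
apply: (@hilbert_function_geq _ _ _ _ _ g) => [[i|j]|c c0] /=.
- exact: dhomogM.
- exact: hb'.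
have cE x : \sum_i c i * (g i).@[x ord0] =
    f.@[x ord0] * (\sum_i c (inl i) * (b i).@[x ord0]) +
    \sum_j c (inr j) * (b' j).@[x ord0].
  rewrite big_sumType /=; congr (_ + _); rewrite mulr_sumr.
  by apply: eq_bigr => i _; rewrite mevalM mulrA mulrC.
have c'0 : forall j, c (inr j) = 0.
  apply: bI' => x Zx; have := c0 x (ZV x Zx).
  by rewrite cE fZ // mul0r add0r.
pose h := \sum_i c (inl i) *: b i.
have hE x : h.@[x ord0] = \sum_i c (inl i) * (b i).@[x ord0].
  by rewrite raddf_sum /=; apply: eq_bigr => i _; rewrite mevalZ.
have hh : h \is t.-homog by rewrite rpred_sum // => i _; rewrite rpredZ.
have h0 x : V x -> h.@[x ord0] = 0.
  apply: (subvariety_mulf_eq0 sV hf hh fV) => {}x Vx.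
  rewrite -[RHS](c0 x Vx) cE hE [X in _ + X]big1 ?addr0 // => j _.
  by rewrite c'0 mul0r.
by move=> [i|//]; apply: (bI (fun i => c (inl i))) => x Vx; rewrite -hE h0.
Qed.

Lemma hilbert_function_mono V s t : subvariety V -> (s <= t)%N ->
  (hilbert_function V s <= hilbert_function V t)%N.
Proof.
move=> sV /subnK <-; elim: (t - s)%N => // k IH; apply: leq_trans IH _.
have [clV [x Vx] _] := sV.
have /rV0Pn[j xj] := proj_closed_neq0 clV Vx.
rewrite addSn -addn1; apply: leq_trans (leq_addr _ _) _.
apply: (@hilbert_function_section V set0 1 'X_j) => //.
  by rewrite dhomogX /= mdeg1.
by exists x; rewrite // mevalXU.
Qed.

(** Each step of a chain raises the order of growth by one. If an equation of
    degree e of Z_s does not vanish on Z_(s+1), the Hilbert function of Z_(s+1)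
    grows by at least that of Z_s whenever its argument grows by e. *)
Lemma has_chain_growth s V : has_chain V s ->
  exists E, forall t, (t ^ s <= hilbert_function V (E * t))%N.
Proof.
move=> [Z [sZ ltZ]].
suff [E ZE] : exists E, forall t, (t ^ s <= hilbert_function (Z s) (E * t))%N.
  exists E => t; apply: leq_trans (ZE t) (hilbert_function_sub _ _).
  exact: (sZ s (leqnn s)).2.
elim: s sZ ltZ => [|s IH] sZ ltZ.
  exists 0%N => t; have [[clZ Z0 _] _] := sZ 0%N (leqnn _).
  by apply: hilbert_function_gt0 => // x; apply: proj_closed_neq0.
have [|k|E IHE] := IH _ _; first by move=> k /leqW; apply: sZ.
  by move=> /ltnW; apply: ltZ.
have [sV _] := sZ s.+1 (leqnn _); have [sW _] := sZ s (leqnSn _).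
have [WV nVW] := ltZ s (leqnn _).
have [x [Vx Wx]] : exists x, Z s.+1 x /\ ~ Z s x.
  by apply: contrapT => /forallNP h; apply: nVW => x Vx; apply: contrapT => Wx;
    apply: (h x).
have [clV _ _] := sV; have [clW _ _] := sW.
have [e [f [hf fW fx]]] := proj_closed_sep clW (proj_closed_neq0 clV Vx) Wx.
exists (e + E)%N => t; rewrite expnS mulnDl.
suff H m : (m * hilbert_function (Z s) (E * t) <=
            hilbert_function (Z s.+1) (e * m + E * t))%N.
  by apply: leq_trans (H t); rewrite leq_mul2l IHE orbT.
elim: m => [|m IHm]; first by rewrite mul0n.
have -> : (e * m.+1 + E * t = e * m + E * t + e)%N.
  by rewrite mulnS -addnA addnC.
rewrite mulSn addnC.
apply: leq_trans (hilbert_function_section _ sV WV hf fW _); last by exists x.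
apply: leq_add IHm (hilbert_function_mono sW _).
by rewrite addnAC leq_addl.
Qed.

End Growth.

Lemma growth_leq r s C E : (forall t, t ^ s <= C * (E * t).+1 ^ r)%N ->
  (s <= r)%N.
Proof.
move=> H; rewrite leqNgt; apply/negP => ltrs.
pose t := (C * E.+1 ^ r).+1; have := H t.
apply/negP; rewrite -ltnNge; apply: (@leq_trans (t ^ r.+1)); last first.
  exact: leq_pexp2l.
apply: (@leq_ltn_trans (C * E.+1 ^ r * t ^ r)); last first.
  by rewrite expnS ltn_pmul2r ?expn_gt0.
rewrite -mulnA -expnMn leq_mul2l; apply/orP; right.
have [->|r_gt0] := posnP r; first by rewrite !expn0.
by rewrite leq_exp2r // mulSn addnC -addn1 leq_add2l.
Qed.

Section Homogeneity.
Variables (K : fieldType).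

Lemma dhomog_prod_ord n m (F : 'I_m -> {mpoly K[n]}) (d : 'I_m -> nat) :
  (forall i, F i \is (d i).-homog) -> \prod_i F i \is (\sum_i d i)%N.-homog.
Proof.
move=> hF; elim/big_rec2: _ => [|i s q _ IH]; first exact: dhomog1.
exact: dhomogM.
Qed.

Lemma dhomog_comp n k d (p : {mpoly K[n]}) (lq : n.-tuple {mpoly K[k]}) :
  p \is d.-homog -> (forall i, tnth lq i \is 1.-homog) ->
  p \mPo lq \is d.-homog.
Proof.
move=> /dhomogP hp hlq; rewrite comp_mpolyEX big_seq rpred_sum // => m /hp <-.
rewrite rpredZ //= comp_mpolyX mdegE; apply: dhomog_prod_ord => i.
by rewrite -{2}[m i]mul1n; apply: dhomogMn.
Qed.

Lemma meval_homog0 n d (p : {mpoly K[n]}) :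
  p \is d.+1.-homog -> p.@[(0 : 'rV[K]_n) ord0] = 0.
Proof.
by move=> hp; have := meval_homogZ 0 0 hp; rewrite scale0r expr0n mul0r.
Qed.

(** Homogeneity of degree e, the outer variable having degree one. *)
Definition graded n e (F : {poly {mpoly K[n]}}) :=
  forall i, if (i <= e)%N then is_true (F`_i \is (e - i).-homog) else F`_i = 0.

Lemma gradedM n d e (F G : {poly {mpoly K[n]}}) :
  graded d F -> graded e G -> graded (d + e) (F * G).
Proof.
move=> hF hG i.
have FG k : (k <= i)%N -> (k <= d)%N -> (i - k <= e)%N ->
    F`_k * G`_(i - k) \is (d + e - i).-homog.
  move=> ki kd ike; have -> : (d + e - i = (d - k) + (e - (i - k)))%N.
    by lia.
  by have := hF k; have := hG (i - k)%N; rewrite kd ike => *; apply: dhomogM.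
have FG0 k : (k <= i)%N -> ~~ ((k <= d)%N && (i - k <= e)%N) ->
    F`_k * G`_(i - k) = 0.
  move=> ki; rewrite negb_and; have := hF k; have := hG (i - k)%N.
  by case: (k <= d)%N => /= [|_ -> _]; rewrite ?mul0r //;
    case: (i - k <= e)%N => //= -> _ _; rewrite mulr0.
rewrite coefM; case: ifP => [_|/negbT ide].
  apply: rpred_sum => -[k /= ki] _.
  by have [/andP[]|/(FG0 _ ki)->] := boolP ((k <= d)%N && (i - k <= e)%N);
    [apply: FG|apply: rpred0].
apply: big1 => -[k /= ki] _; apply: FG0 => //; apply: contra ide => /andP[kd].
by rewrite leq_subLR => /leq_trans; apply; rewrite leq_add2r.
Qed.

Lemma graded1 n : graded 0 (1 : {poly {mpoly K[n]}}).
Proof. by case=> [|i]; rewrite coef1 //= dhomog1. Qed.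

Lemma graded_prod n m (F : 'I_m -> {poly {mpoly K[n]}}) (d : 'I_m -> nat) :
  (forall i, graded (d i) (F i)) -> graded (\sum_i d i)%N (\prod_i F i).
Proof.
move=> hF; elim/big_rec2: _ => [|i s q _ IH]; first exact: graded1.
exact: gradedM.
Qed.

Lemma gradedX n d k (F : {poly {mpoly K[n]}}) :
  graded d F -> graded (k * d) (F ^+ k).
Proof.
move=> hF; elim: k => [|k IH]; first exact: graded1.
by rewrite exprS mulSn; apply: gradedM.
Qed.

Lemma coef_linear (R : nzRingType) (a b : R) k : (a%:P + b%:P * 'X)`_k =
  if k is i.+1 then (if i is _.+1 then 0 else b) else a.
Proof. by case: k => [|[|k]]; rewrite coefD coefMX !coefC /= ?addr0 ?add0r. Qed.

Lemma graded_linear n (a b : {mpoly K[n]}) :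
  a \is 1.-homog -> b \is 0.-homog -> graded 1 (a%:P + b%:P * 'X).
Proof. by move=> ha hb k; rewrite coef_linear; case: k => [|[|k]]. Qed.

Lemma dhomog_mpolyC n (c : K) : c%:MP_[n] \is 0.-homog.
Proof. by rewrite -[c%:MP]mulr1 mul_mpolyC rpredZ // dhomog1. Qed.

Lemma graded_sum n d (I : eqType) (r : seq I) (F : I -> {poly {mpoly K[n]}}) :
  (forall i, i \in r -> graded d (F i)) -> graded d (\sum_(i <- r) F i).
Proof.
move=> hF k; rewrite coef_sum; case: ifP => kd.
  by rewrite big_seq rpred_sum // => i /hF/(_ k); rewrite kd.
by rewrite big_seq big1 // => i /hF/(_ k); rewrite kd.
Qed.

End Homogeneity.

(** * Projection from a point *)

Lemma map_resultant_comm (aR rR : comNzRingType) (f : {rmorphism aR -> rR})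
    (p q : {poly aR}) :
  f (lead_coef p) != 0 -> f (lead_coef q) != 0 ->
  f (resultant p q) = resultant (map_poly f p) (map_poly f q).
Proof.
move=> nz_fp nz_fq; rewrite /resultant /Sylvester_mx !size_map_poly_id0 //.
rewrite -det_map_mx map_col_mx; congr (\det (col_mx _ _));
  apply/matrixP => i k; rewrite !mxE /= !rVpoly_delta -coef_map;
  by rewrite rmorphM /= map_polyXn.
Qed.

(** By [cone_separation] the equations of a cone may be given as arbitrary
    polynomials. *)
Lemma closed_of_separation (K : closedFieldType) n (V : set 'rV[K]_n.+1) :
  V `<=` [set x | x != 0] -> (forall c x, c != 0 -> V x -> V (c *: x)) ->
  (forall y, y != 0 -> ~ V y -> exists2 D : {mpoly K[n.+1]},
     forall x, V x -> D.@[x ord0] = 0 & D.@[y ord0] != 0) ->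
  proj_closed V.
Proof.
move=> V0 VZ Vsep; exists [set p | (exists d, p \is d.-homog) /\
  forall x, V x -> p.@[x ord0] = 0]; split=> [p []//|].
apply/seteqP; split=> [x Vx|x [x0 Sx]].
  by split; [exact: V0|move=> p [_]; apply].
apply: contrapT => nVx; have [D DV Dx] := Vsep x x0 nVx.
have [d [f [hf fV /eqP]]] := cone_separation VZ DV Dx; apply.
by apply: Sx; split=> //; exists d.
Qed.

Section Projection.
Variables (K : closedFieldType) (n : nat) (p : 'rV[K]_n.+2) (j : 'I_n.+2).
Hypothesis pj : p 0 j = 1.
Implicit Types (Y : set 'rV[K]_n.+2) (Z : set 'rV[K]_n.+1).

Definition proj_from (x : 'rV[K]_n.+2) : 'rV[K]_n.+1 :=
  \row_k (x 0 (lift j k) - x 0 j * p 0 (lift j k)).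

(** The point of the line through p over y with j-th coordinate a, for p
    normalized by p_j = 1. *)
Definition fiber_point (y : 'rV[K]_n.+1) (a : K) : 'rV[K]_n.+2 :=
  \row_i ((if unlift j i is Some k then y 0 k else 0) + a * p 0 i).

Lemma fiber_pointj y a : fiber_point y a 0 j = a.
Proof. by rewrite mxE unlift_none add0r pj mulr1. Qed.

Lemma fiber_pointK y a : proj_from (fiber_point y a) = y.
Proof.
apply/rowP => k; rewrite mxE fiber_pointj mxE liftK.
by rewrite addrK.
Qed.

Lemma proj_fromK x : fiber_point (proj_from x) (x 0 j) = x.
Proof.
apply/rowP => i; rewrite mxE; case: unliftP => [k ->|->].
  by rewrite mxE subrK.
by rewrite add0r pj mulr1.
Qed.

Lemma proj_fromZ c x : proj_from (c *: x) = c *: proj_from x.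
Proof. by apply/rowP => k; rewrite !mxE mulrBr mulrA. Qed.

Lemma fiber_point0 a : fiber_point 0 a = a *: p.
Proof.
by apply/rowP => i; rewrite !mxE; case: unliftP => [k _|_]; rewrite ?mxE add0r.
Qed.

(** Restriction of a polynomial to the lines through p, as a polynomial in the
    coordinate along the line. *)
Definition line_poly (f : {mpoly K[n.+2]}) : {poly {mpoly K[n.+1]}} :=
  mmap (@polyC {mpoly K[n.+1]} \o @mpolyC n.+1 K)
    (fun i => (if unlift j i is Some k then 'X_k else 0)%:P
              + (p 0 i)%:MP%:P * 'X) f.

Definition specialize (y : 'rV[K]_n.+1) (F : {poly {mpoly K[n.+1]}}) : {poly K} :=
  map_poly (meval (y ord0)) F.

Lemma line_polyE f y a :
  (specialize y (line_poly f)).[a] = f.@[fiber_point y a ord0].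
Proof.
rewrite /specialize /line_poly /mmap (raddf_sum (map_poly _)) horner_sum mevalE.
apply: eq_bigr => m _ /=.
rewrite rmorphM hornerM /= map_polyC hornerC /= mevalC; congr (_ * _).
rewrite /mmap1 rmorph_prod horner_prod; apply: eq_bigr => i _.
rewrite rmorphXn horner_exp; congr (_ ^+ _).
rewrite rmorphD rmorphM hornerD hornerM /= !map_polyC map_polyX !hornerC hornerX.
rewrite /= mevalC mxE mulrC; congr (_ + _).
by case: unliftP => [k _|_]; rewrite ?mevalXU ?meval0.
Qed.

Lemma line_poly_proj f x :
  (specialize (proj_from x) (line_poly f)).[x 0 j] = f.@[x ord0].
Proof. by rewrite line_polyE proj_fromK. Qed.

Lemma graded_line_poly d f : f \is d.-homog -> graded d (line_poly f).
Proof.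
move=> /dhomogP hf; rewrite /line_poly /mmap; apply: graded_sum => m /hf /= <-.
rewrite -[X in graded X]add0n mdegE; apply: gradedM.
  case=> [|i] /=; rewrite coefC //=.
  exact: dhomog_mpolyC.
apply: graded_prod => i; rewrite -[X in graded X]muln1; apply: gradedX.
apply: graded_linear; last exact: dhomog_mpolyC.
case: unliftP => [k _|_]; last exact: rpred0.
by rewrite dhomogX /= mdeg1.
Qed.

Lemma size_line_poly d f : f \is d.-homog -> (size (line_poly f) <= d.+1)%N.
Proof.
move=> /graded_line_poly hf; apply/leq_sizeP => i; rewrite leqNgt ltnS => di.
by have := hf i; rewrite (negPf di).
Qed.

(** Along a line through p the leading coefficient of f is the constant f(p):
    lines through a point p outside of f = 0 all meet this hypersurface in the
    same number of points, counted with multiplicity. *)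
Lemma line_poly_lead d f : f \is d.-homog ->
  (line_poly f)`_d = (f.@[p ord0])%:MP.
Proof.
move=> hf; have gf := graded_line_poly hf.
have : (line_poly f)`_d \is 0.-homog.
  by have := gf d; rewrite leqnn subnn.
move=> /dhomogP h0.
have [c cE] : exists c, (line_poly f)`_d = c%:MP.
  exists ((line_poly f)`_d)@_0; apply: msize1_polyC.
  rewrite msizeE; apply/bigmax_leqP_seq => m /h0 /= -> //.
rewrite cE; congr (_%:MP); have := line_polyE f 0 1.
rewrite fiber_point0 scale1r => <-.
rewrite (@horner_coef_wide _ d.+1); last first.
  by apply: leq_trans (size_poly _ _) (size_line_poly hf).
rewrite big_ord_recr /= coef_map /= cE mevalC expr1n mulr1 big1 ?add0r // => i _.
rewrite coef_map /=; have := gf i; rewrite (ltnW (ltn_ord i)).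
rewrite -[(d - i)%N]prednK ?subn_gt0 // => /meval_homog0 ->.
by rewrite mul0r.
Qed.

Lemma line_poly_size d f : f \is d.-homog -> f.@[p ord0] != 0 ->
  size (line_poly f) = d.+1 /\ lead_coef (line_poly f) = (f.@[p ord0])%:MP.
Proof.
move=> hf fp; have sz : size (line_poly f) = d.+1.
  apply/eqP; rewrite eqn_leq size_line_poly //= ltnNge; apply/negP.
  move=> /leq_sizeP/(_ d (leqnn d)); rewrite (line_poly_lead hf) => /eqP.
  by rewrite mpolyC_eq0 (negPf fp).
by rewrite lead_coefE sz /= line_poly_lead.
Qed.

Definition proj_image Y : set 'rV[K]_n.+1 := proj_from @` Y.

Section AwayFromCenter.
Variable Y : set 'rV[K]_n.+2.
Hypotheses (clY : proj_closed Y) (pY : ~ Y p).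

Lemma proj_from_neq0 x : Y x -> proj_from x != 0.
Proof.
move=> Yx; apply/eqP => px0; apply: pY.
have := proj_fromK x; rewrite px0 fiber_point0 => xE.
have x0 := proj_closed_neq0 clY Yx.
have xj : x 0 j != 0 by apply: contraNneq x0 => xj; rewrite -xE xj scale0r.
have -> : p = (x 0 j)^-1 *: x by rewrite -{2}xE scalerA mulVf // scale1r.
by apply: proj_closedZ => //; rewrite invr_eq0.
Qed.

(** An equation missing p is multiplied by a coordinate, as the elimination by
    resultants needs a positive degree. *)
Lemma center_separation : exists e f, [/\ f \is e.+1.-homog,
  forall x, Y x -> f.@[x ord0] = 0 & f.@[p ord0] != 0].
Proof.
have p0 : p != 0 by apply/rV0Pn; exists j; rewrite pj oner_eq0.
have [e [f [hf fY fp]]] := proj_closed_sep clY p0 pY.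
exists e, (f * 'X_j); split=> [|x /fY fx|].
- by rewrite -[e.+1]addn1; apply: dhomogM; rewrite // dhomogX /= mdeg1.
- by rewrite mevalM fx mul0r.
- by rewrite mevalM mevalXU [p _ _]pj mulr1.
Qed.

Lemma finite_fibers y : exists s : seq K,
  forall a, Y (fiber_point y a) -> a \in s.
Proof.
have [e [f [hf fY fp]]] := center_separation.
have [sz lf] := line_poly_size hf fp.
have Q0 : specialize y (line_poly f) != 0.
  rewrite -size_poly_eq0 size_map_poly_id0 ?sz // lf.
  by rewrite mevalC.
have [s Qs] := closed_field_poly_normal (specialize y (line_poly f)).
exists s => a Ya; rewrite -root_prod_XsubC.
have : root (specialize y (line_poly f)) a.
  by rewrite /root line_polyE fY.
by rewrite Qs rootZ // lead_coef_eq0.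
Qed.

End AwayFromCenter.
End Projection.

Section ClosedProjection.
Variables (K : closedFieldType) (n : nat) (p : 'rV[K]_n.+2) (j : 'I_n.+2).
Hypothesis pj : p 0 j = 1.
Variable Y : set 'rV[K]_n.+2.
Hypotheses (clY : proj_closed Y) (pY : ~ Y p).

(** One equation of Y can avoid finitely many points at once: a combination
    g + c h misses them for all but finitely many scalars c. *)
Lemma fiber_avoiding y (s : seq K) : y != 0 ->
  (forall a, ~ Y (fiber_point p j y a)) ->
  exists2 g : {mpoly K[n.+2]}, forall x, Y x -> g.@[x ord0] = 0
    & forall a, a \in s -> g.@[fiber_point p j y a ord0] != 0.
Proof.
move=> y0 nY; elim: s => [|a s [g gY gs]].
  by exists 0 => [x _|a //]; rewrite meval0.
have xa0 : fiber_point p j y a != 0.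
  apply: contraNneq y0 => xa0; rewrite -(fiber_pointK pj y a) xa0.
  by rewrite -(scale0r 0) proj_fromZ scale0r.
have [d [h [_ hY ha]]] := proj_closed_sep clY xa0 (nY a).
pose R := \prod_(b <- a :: s) (h.@[fiber_point p j y b ord0] *: 'X
                               + g.@[fiber_point p j y b ord0]%:P).
have /closed_nonrootP[c Rc] : R != 0.
  rewrite prodf_seq_neq0; apply/allP => b /=; rewrite inE => bs.
  apply: contraTneq isT => Rb0.
  have := congr1 (fun q : {poly K} => q`_0) Rb0.
  have := congr1 (fun q : {poly K} => q`_1) Rb0.
  rewrite !coefD !coefZ !coefX !coefC /= !(mulr1, mulr0, addr0, add0r) => hb gb.
  by case/predU1P: bs => [ba|/gs]; [move: ha; rewrite -ba hb|rewrite gb];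
    rewrite eqxx.
exists (g + c *: h) => [x Yx|b bs].
  by rewrite mevalD mevalZ gY ?hY ?mulr0 ?addr0.
move: Rc; rewrite /root horner_prod prodf_seq_neq0 => /allP/(_ b bs) /=.
by rewrite hornerD hornerZ hornerX hornerC mevalD mevalZ addrC mulrC.
Qed.

(** Elimination: at a point y whose fibre misses Y, an equation f of Y not
    vanishing at p and an equation g of Y without common root with f on the line
    over y have a resultant that vanishes on the projection but not at y. *)
Lemma proj_image_closed : proj_closed (proj_image p j Y).
Proof.
apply: closed_of_separation => [_ [x Yx <-]|c _ c0 [x Yx <-]|y y0 nY].
- exact: (proj_from_neq0 pj clY pY Yx).
- by exists (c *: x); [apply: proj_closedZ|rewrite proj_fromZ].
have nYa a : ~ Y (fiber_point p j y a).
  by move=> Ya; apply: nY; exists (fiber_point p j y a); rewrite ?fiber_pointK.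
have [e [f [hf fY fp]]] := center_separation pj clY pY.
have [F FE] : exists F, F = line_poly p j f.
  exact: (ex_intro _ _ erefl).
have [szF lF] : size F = e.+2 /\ lead_coef F = (f.@[p ord0])%:MP.
  by rewrite FE; apply: line_poly_size.
have F0 : F != 0 by rewrite -size_poly_eq0 szF.
have lFy : (meval (y ord0)) (lead_coef F) != 0 by rewrite lF mevalC.
have Fy0 : specialize y F != 0.
  by rewrite -size_poly_eq0 size_map_poly_id0 ?szF.
have [s Fs] := closed_field_poly_normal (specialize y F).
have [g gY gs] := fiber_avoiding s y0 nYa.
have [G0 G0E] : exists G0, G0 = line_poly p j g.
  exact: (ex_intro _ _ erefl).
(* Adding a high multiple of F makes the leading coefficient constant without
   changing the values at the roots of F. *)
have [k kE] : exists k, k = size G0.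
  exact: (ex_intro _ _ erefl).
have szFX : size (F * 'X^k) = (k + e.+2)%N by rewrite size_mulXn ?szF.
have ltG0 : (size G0 < size (F * 'X^k)%R)%N.
  by rewrite szFX -kE addnS ltnS leq_addr.
have [G GE] : exists G, G = G0 + F * 'X^k.
  exact: (ex_intro _ _ erefl).
have szG : size G = (k + e.+2)%N by rewrite GE addrC size_polyDl.
have lG : lead_coef G = lead_coef F.
  by rewrite GE addrC lead_coefDl // lead_coef_Mmonic // monicXn.
exists (resultant F G) => [_ [x Yx <-]|].
- have [|| [u v] _ /= uv] := @resultant_in_ideal _ F G; first by rewrite szF.
    by rewrite szG !addnS.
  have ev (q : {mpoly K[n.+1]}) : q.@[proj_from p j x ord0] =
      (specialize (proj_from p j x) q%:P).[x 0 j].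
    by rewrite /specialize map_polyC hornerC.
  have Fx : (specialize (proj_from p j x) F).[x 0 j] = 0.
    by rewrite FE line_poly_proj // fY.
  have G0x : (specialize (proj_from p j x) G0).[x 0 j] = 0.
    by rewrite G0E line_poly_proj // gY.
  rewrite ev uv GE.
  move: Fx G0x; rewrite /specialize !(rmorphD, rmorphM) /=.
  by rewrite !(hornerD, hornerM) => -> ->; rewrite mul0r !(mulr0, addr0).
- rewrite [_.@[_]]map_resultant_comm ?lG // resultant_eq0 -leqNgt leqNgt.
  apply/negP => sz1.
  have /closed_rootP[a] : size (gcdp (specialize y F) (specialize y G)) != 1.
    by rewrite gtn_eqF.
  rewrite root_gcd => /andP[Fa Ga].
  have sa : a \in s.
    by move: Fa; rewrite Fs rootZ ?lead_coef_eq0 // root_prod_XsubC.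
  have /negP := gs a sa; apply; rewrite -line_polyE // -G0E.
  move: Ga Fa; rewrite GE /root /specialize rmorphD rmorphM hornerD hornerM /=.
  move=> + /eqP Fa.
  by rewrite Fa mul0r addr0.
Qed.

End ClosedProjection.

Section LiftingSubvarieties.
Variables (K : closedFieldType) (n : nat) (p : 'rV[K]_n.+2) (j : 'I_n.+2).
Hypothesis pj : p 0 j = 1.
Implicit Types (Y : set 'rV[K]_n.+2) (Z : set 'rV[K]_n.+1).

Lemma proj_preimage_closed Y Z : proj_closed Y -> ~ Y p -> proj_closed Z ->
  proj_closed (Y `&` (proj_from p j @^-1` Z)).
Proof.
move=> clY pY clZ; apply: closed_of_separation.
- by move=> x [Yx _]; apply: (proj_closed_neq0 clY).
- move=> c x c0 [Yx Zx]; split; first exact: proj_closedZ.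
  by rewrite /= proj_fromZ; apply: proj_closedZ.
- move=> y y0 /not_andP[nY|nZ].
    have [d [f [_ fY fy]]] := proj_closed_sep clY y0 nY.
    by exists f => // x [/fY].
  have [Yy|nY] := pselect (Y y); last first.
    have [d [f [_ fY fy]]] := proj_closed_sep clY y0 nY.
    by exists f => // x [/fY].
  have [d [f [_ fZ fy]]] := proj_closed_sep clZ (proj_from_neq0 pj clY pY Yy) nZ.
  pose lq := [tuple 'X_(lift j k) - p 0 (lift j k) *: 'X_j | k < n.+1]
    : n.+1.-tuple {mpoly K[n.+2]}.
  have lqE (x : 'rV[K]_n.+2) : (f \mPo lq).@[x ord0] = f.@[proj_from p j x ord0].
    rewrite comp_mpoly_meval; apply: meval_eq => k.
    by rewrite tnth_mktuple mevalB mevalZ !mevalXU mxE mulrC.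
  by exists (f \mPo lq) => [x [_ /fZ]|]; rewrite lqE.
Qed.

Lemma proj_image_subvariety Y : subvariety Y -> ~ Y p ->
  subvariety (proj_image p j Y).
Proof.
move=> [clY [y Yy] irrY] pY; split; first exact: proj_image_closed.
  by exists (proj_from p j y), y.
move=> A B clA clB YAB.
have [x Yx|YA|YB] := irrY _ _ (proj_preimage_closed clY pY clA)
  (proj_preimage_closed clY pY clB).
- by case: (YAB (proj_from p j x)) => [|Ax|Bx]; [exists x|left|right].
- by left=> _ [x /YA[_ Ax] <-].
- by right=> _ [x /YB[_ Bx] <-].
Qed.

(** Compactness of the fibres: in a chain of sets that each meet a finite set,
    one point of the finite set belongs to all of them. *)
Lemma chain_finite_meet (T : eqType) (F : set (set T)) (s : seq T) :
  total_on F subset -> (forall A, F A -> exists2 a, a \in s & A a) ->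
  F !=set0 -> exists2 a, a \in s & forall A, F A -> A a.
Proof.
move=> totF + [A0 FA0]; elim: s => [|a s IH] Fs; first by have [] := Fs _ FA0.
have [Fa|/existsNP[A1 /not_implyP[FA1 A1a]]] := pselect (forall A, F A -> A a).
  by exists a; rewrite // mem_head.
have [A FA|b bs Fb] := IH; last by exists b; rewrite // inE bs orbT.
have [AA1|A1A] := totF _ _ FA FA1.
  have [b] := Fs _ FA; rewrite inE => /predU1P[->|bs Ab]; last by exists b.
  by move=> /AA1.
by have [b] := Fs _ FA1; rewrite inE => /predU1P[->//|bs /A1A Ab]; exists b.
Qed.

(** A minimal closed subset of Y that still projects onto Z is irreducible;
    it exists because the fibres are finite. *)
Lemma subvariety_lift Y Z : proj_closed Y -> ~ Y p -> subvariety Z ->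
  Z `<=` proj_image p j Y ->
  exists Y', [/\ subvariety Y', Y' `<=` Y & proj_image p j Y' = Z].
Proof.
move=> clY pY sZ ZY; have [clZ [z0 Zz0] irrZ] := sZ.
pose good A := [/\ proj_closed A, A `<=` Y & Z `<=` proj_image p j A].
pose T := {A | good A}.
pose R (A B : T) := `[< sval B `<=` sval A >].
have [||||[M gM] minM] := @Zorn T R.
- by move=> A; apply/asboolP.
- by move=> A B C /asboolP BA /asboolP CB; apply/asboolP => x /CB/BA.
- move=> [A gA] [B gB] /asboolP/= BA /asboolP/= AB.
  have eAB : A = B by apply/seteqP.
  by move: gA gB BA AB; rewrite eAB => gA gB _ _; rewrite (Prop_irrelevance gA gB).
- move=> F totF; have [[A0 FA0]|F0] := pselect (F !=set0); last first.
    have gY : good Y by split.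
    exists (exist _ Y gY) => A FA; case: F0; by exists A.
  pose I := [set x | forall A, F A -> sval A x].
  suff gI : good I by exists (exist _ I gI) => A FA; apply/asboolP => x; apply.
  split.
  + apply: closed_of_separation.
    * move=> x /(_ _ FA0); have [clA _ _] := svalP A0.
      exact: proj_closed_neq0 clA.
    * move=> c x c0 Ix A FA; have [clA _ _] := svalP A.
      by apply: proj_closedZ; rewrite //; apply: Ix.
    * move=> y y0 /existsNP[A /not_implyP[FA nAy]]; have [clA _ _] := svalP A.
      have [d [f [_ fA fy]]] := proj_closed_sep clA y0 nAy.
      by exists f => // x /(_ _ FA)/fA.
  + by move=> x /(_ _ FA0); have [_ AY _] := svalP A0; apply: AY.
  (* The sets of the chain cut nonempty subsets of a finite fibre over z. *)
  + move=> z Zz; have [s sY] := finite_fibers pj clY pY z.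
    pose G := [set (fun a => sval A (fiber_point p j z a)) | A in F].
    have [|_ [A FA <-]||a as_ Ga] := @chain_finite_meet _ G s.
    * move=> _ _ [A FA <-] [B FB <-].
      by have [/asboolP AB|/asboolP BA] := totF _ _ FA FB;
        [right=> a /AB|left=> a /BA].
    * have [_ AY /(_ z Zz)[x Ax xz]] := svalP A.
      have xE : fiber_point p j z (x 0 j) = x by rewrite -xz proj_fromK.
      by exists (x 0 j); rewrite ?xE //; apply: sY; rewrite xE; apply: AY.
    * by exists (fun a => sval A0 (fiber_point p j z a)), A0.
    * exists (fiber_point p j z a); rewrite ?fiber_pointK // => A FA.
      by apply: (Ga (fun a => sval A (fiber_point p j z a))); exists A.
have [clM MY ZM] := gM.
have {}minM A : proj_closed A -> A `<=` M -> Z `<=` proj_image p j A -> M = A.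
  move=> clA AM ZA; have gA : good A by split=> // x /AM/MY.
  by have /(congr1 sval) /= -> // := minM (exist _ A gA) (introT (asboolP _) AM).
have pM : ~ M p by move/MY.
have MZ : M = M `&` (proj_from p j @^-1` Z).
  apply: minM; [exact: proj_preimage_closed|by move=> x []|].
  move=> z Zz; have [x Mx xz] := ZM z Zz.
  by exists x; rewrite //; split; rewrite //= xz.
exists M; split=> //; last first.
  by apply/seteqP; split=> // _ [x + <-]; rewrite MZ => -[].
split=> //; first by have [x Mx _] := ZM _ Zz0; exists x.
move=> A B clA clB MAB.
have clMA := proj_closedI clM clA; have clMB := proj_closedI clM clB.
have pMI C : ~ (M `&` C) p by move=> [].
have [z Zz|ZA|ZB] := irrZ _ _ (proj_image_closed pj clMA (pMI A))
  (proj_image_closed pj clMB (pMI B)).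
- have [x Mx xz] := ZM z Zz.
  by case: (MAB x Mx) => [Ax|Bx]; [left|right]; exists x.
- by left=> x; rewrite (minM _ clMA _ ZA) => [[]|y []] .
- by right=> x; rewrite (minM _ clMB _ ZB) => [[]|y []].
Qed.

Lemma chain_subset (T : Type) (Z : nat -> set T) r :
  (forall k, (k < r)%N -> Z k `<=` Z k.+1) ->
  forall i k, (i <= k)%N -> (k <= r)%N -> Z i `<=` Z k.
Proof.
move=> leZ i; elim=> [|k IH]; first by rewrite leqn0 => /eqP -> _ x.
rewrite leq_eqVlt => /predU1P[-> _ x //|ik kr].
by apply: (@subset_trans _ (Z k)); [apply: IH (ltnW kr)|apply: leZ].
Qed.

(** The chain is lifted from its top, the lift of each member being sought inside
    the lift of the next one. *)
Lemma chain_lift r Y (Z : nat -> set 'rV[K]_n.+1) : proj_closed Y -> ~ Y p ->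
  (forall k, (k <= r)%N -> subvariety (Z k) /\ Z k `<=` proj_image p j Y) ->
  (forall k, (k < r)%N -> Z k `<=` Z k.+1) ->
  exists Y' : nat -> set 'rV[K]_n.+2,
    (forall k, (k <= r)%N -> [/\ subvariety (Y' k), Y' k `<=` Y
       & proj_image p j (Y' k) = Z k]) /\
    (forall k, (k < r)%N -> Y' k `<=` Y' k.+1).
Proof.
elim: r Y => [|r IH] Y clY pY sZ ltZ.
  have [sZ0 Z0Y] := sZ 0%N (leqnn _).
  have [Y0 [sY0 Y0Y Y0Z]] := subvariety_lift clY pY sZ0 Z0Y.
  by exists (fun=> Y0); split=> // -[].
have [sZr ZrY] := sZ r.+1 (leqnn _).
have [W [sW WY WZ]] := subvariety_lift clY pY sZr ZrY.
have [clW _ _] := sW; have pW : ~ W p by move/WY.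
have [k kr|k kr|Y' [sY' ltY']] := IH W clW pW.
- split; first by have [] := sZ k (leqW kr).
  by rewrite WZ; apply: (chain_subset ltZ); rewrite ?(leqW kr).
- exact/ltZ/ltnW.
exists (fun k => if (k <= r)%N then Y' k else W); split=> k kr.
  have [kr'|kr'] := leqP k r.
    by have [? Y'W ?] := sY' k kr'; split=> // x /Y'W/WY.
  by have -> : k = r.+1 by lia.
rewrite -ltnS kr; have [kr'|kr'] := leqP k.+1 r; first exact: ltY'.
by have [] := sY' k kr.
Qed.

Lemma has_chain_lift r Y : proj_closed Y -> ~ Y p ->
  has_chain (proj_image p j Y) r -> has_chain Y r.
Proof.
move=> clY pY [Z [sZ ltZ]].
have [k /ltZ[]//|Y' [sY' leY']] := chain_lift clY pY sZ.
exists Y'; split=> k kr; first by have [] := sY' k kr.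
split; first exact: leY'.
have [_ _ YZ] := sY' k (ltnW kr); have [_ _ YZ'] := sY' k.+1 kr.
have [_ nZ] := ltZ k kr; apply: contra_not nZ => Y'k.
by rewrite -YZ -YZ' => _ [x /Y'k Yx <-]; exists x.
Qed.

End LiftingSubvarieties.

Section SpanClosure.
Variables (K : fieldType) (T : Type) (V : set T) (J : finType) (g : J -> T -> K).

Lemma span_on_mem k : span_on V g (g k).
Proof.
exists (fun i => (i == k)%:R) => x _.
by rewrite (bigD1 k) //= eqxx mul1r big1 ?addr0 // => i /negPf->; rewrite mul0r.
Qed.

Lemma span_on_sum (I : finType) (c : I -> K) (h : I -> T -> K) (h' : T -> K) :
  (forall k, span_on V g (h k)) ->
  (forall x, V x -> h' x = \sum_k c k * h k x) -> span_on V g h'.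
Proof.
move=> /choice[C hC] h'E; exists (fun i => \sum_k c k * C k i) => x Vx.
rewrite h'E //; under eq_bigr => k _ do rewrite hC // mulr_sumr.
rewrite exchange_big; apply: eq_bigr => i _; rewrite mulr_suml.
by apply: eq_bigr => k _; rewrite mulrA.
Qed.

End SpanClosure.

Section ProjectionHilbert.
Variables (K : closedFieldType) (n : nat) (p : 'rV[K]_n.+2) (j : 'I_n.+2).
Hypothesis pj : p 0 j = 1.

(** The coordinate ring of Y is generated, as a module over that of its
    projection, by the powers of one coordinate below the degree of an equation
    of Y that does not vanish at the centre. *)
Lemma hilbert_function_proj (Y : set 'rV[K]_n.+2) : subvariety Y -> ~ Y p ->
  exists e, forall t,
    (hilbert_function Y t <= e * hilbert_function (proj_image p j Y) t)%N.
Proof.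
move=> sY pY; have [clY _ _] := sY.
have sZ := proj_image_subvariety pj sY pY.
set Z := proj_image p j Y in sZ *.
have [e [f [hf fY fp]]] := center_separation pj clY pY.
exists e.+1 => t.
pose B s := sval (cid (hilbert_basis Z s)).
have BP s : forall b, b \is s.-homog ->
    span_on Z (fun k x => (B s k).@[x ord0]) (fun x => b.@[x ord0]).
  by have [] := svalP (cid (hilbert_basis Z s)).
pose J := {i : 'I_e.+1 & 'I_(hilbert_function Z (t - i))}.
pose g (k : J) (x : 'rV[K]_n.+2) :=
  x 0 j ^+ (tag k) * (B _ (tagged k)).@[proj_from p j x ord0].
apply: (@leq_trans #|{: J}|); last first.
  rewrite card_tagged sumnE big_map big_enum /= -[X in (_ <= X * _)%N]card_ord.
  rewrite -sum_nat_const; apply: leq_sum => i _; rewrite card_ord.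
  by apply: hilbert_function_mono => //; apply: leq_subr.
apply: (@hilbert_function_leq _ _ _ _ _ g) => q hq.
have key i s b : (i + s = t)%N -> b \is s.-homog ->
    span_on Y g (fun x => x 0 j ^+ i * b.@[proj_from p j x ord0]).
  have [m] := ubnP i; elim: m i s b => // m IH i s b im ist hb.
  have [ie|ei] := ltnP i e.+1.
    have hs : s = (t - i)%N by rewrite -ist addKn.
    rewrite hs in hb; have [c cE] := BP _ _ hb.
    apply: (@span_on_sum _ _ Y _ g _ c
      (fun k => g (existT _ (Ordinal ie) k))) => [k|x Yx].
      exact: span_on_mem.
    rewrite cE; last by exists x.
    by rewrite mulr_sumr; apply: eq_bigr => k _; rewrite mulrCA.
  (* Higher powers are lowered by the equation f, whose leading coefficient along
     the line is the nonzero constant c0. *)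
  pose F := line_poly p j f; pose c0 := f.@[p ord0].
  apply: (@span_on_sum _ _ Y _ g 'I_e.+1 (fun=> - c0^-1) (fun k x =>
     x 0 j ^+ (k + (i - e.+1)) * (F`_k * b).@[proj_from p j x ord0])).
    move=> k; apply: (IH _ (e.+1 - k + s)%N); first by have := ltn_ord k; lia.
      by have := ltn_ord k; lia.
    apply: dhomogM => //.
    by have := graded_line_poly p j hf k; rewrite (ltnW (ltn_ord k)).
  move=> x Yx; rewrite -mulr_sumr.
  have := line_poly_proj pj f x; rewrite fY // -/F.
  rewrite (@horner_coef_wide _ e.+2); last first.
    by apply: leq_trans (size_poly _ _) (size_line_poly p j hf).
  rewrite big_ord_recr /= coef_map /= (line_poly_lead p j hf) mevalC -/c0.
  move=> /eqP; rewrite addrC addr_eq0 => /eqP F0.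
  have -> : x 0 j ^+ i = - c0^-1 * (- (c0 * x 0 j ^+ e.+1)) * x 0 j ^+ (i - e.+1).
    by rewrite mulrNN mulKf // -exprD subnKC.
  rewrite F0 opprK -!mulrA; congr (_ * _); rewrite mulr_suml.
  apply: eq_bigr => k _; rewrite coef_map /= mevalM exprD.
  by rewrite [_ * x 0 j ^+ k]mulrC mulrACA.
apply: (@span_on_sum _ _ Y _ g 'I_t.+1 (fun=> 1) (fun k x =>
  x 0 j ^+ k * ((line_poly p j q)`_k).@[proj_from p j x ord0])) => [k|x Yx].
  apply: (key _ (t - k)%N); first by rewrite subnKC // -ltnS.
  by have := graded_line_poly p j hq k; rewrite -ltnS ltn_ord.
rewrite -(line_poly_proj pj) (@horner_coef_wide _ t.+1); last first.
  by apply: leq_trans (size_poly _ _) (size_line_poly p j hq).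
by apply: eq_bigr => k _; rewrite coef_map mul1r mulrC.
Qed.

End ProjectionHilbert.

(** * Dimension as the growth order of the Hilbert function *)

Section ProjectiveSpace.
Variables (K : closedFieldType) (n : nat).

Definition coordinate_flag (k : nat) : set 'rV[K]_n.+1 :=
  [set x : 'rV[K]_n.+1 | x != 0 /\ forall i : 'I_n.+1, (k < i)%N -> x 0 i = 0].

(** Two nonempty open subsets of a linear space meet on any line joining
    a point of one to a point of the other. *)
Lemma coordinate_flag_subvariety k : subvariety (coordinate_flag k).
Proof.
apply: prime_subvariety.
- exists [set 'X_i | i in [set i : 'I_n.+1 | (k < i)%N]]; split.
    by move=> _ [i _ <-]; exists 1%N; rewrite dhomogX /= mdeg1.
  apply/seteqP; split=> x [x0 xk]; split=> //.
    by move=> _ [i ki <-]; rewrite mevalXU xk.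
  by move=> i ki; rewrite -[LHS](mevalXU (x ord0)); apply: xk; exists i.
- exists (delta_mx 0 0); split=> [|i ki].
    by apply/rV0Pn; exists 0; rewrite mxE !eqxx oner_eq0.
  by rewrite mxE; case: i ki => -[].
move=> _ _ f g _ _ [x [x0 xk] fx] [y [y0 yk] gy].
have /rV0Pn[i xi] := x0.
pose P (q : {mpoly K[n.+1]}) := mmap (@polyC K)
  (fun i => (x 0 i)%:P + (y 0 i - x 0 i) *: 'X) q.
have PE q s : (P q).[s] = q.@[(x + s *: (y - x)) ord0].
  rewrite /P /mmap horner_sum mevalE; apply: eq_bigr => m _.
  rewrite hornerM hornerC; congr (_ * _).
  rewrite horner_prod; apply: eq_bigr => l _; rewrite horner_exp; congr (_ ^+ _).
  by rewrite hornerD hornerC hornerZ hornerX !mxE mulrC.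
have P0 q s : q.@[(x + s *: (y - x)) ord0] != 0 -> P q != 0.
  by apply: contraNneq => Pq0; rewrite -PE Pq0 horner0.
have /closed_nonrootP[s] : P f * P g * P 'X_i != 0.
  rewrite !mulf_neq0 //.
  - by apply: (P0 _ 0); rewrite scale0r addr0.
  - by apply: (P0 _ 1); rewrite scale1r addrC subrK.
  - by apply: (P0 _ 0); rewrite scale0r addr0 mevalXU.
rewrite !rootM !negb_or /root !PE => /andP[/andP[fs gs] si].
exists (x + s *: (y - x)); split=> //; split=> [|l kl].
  apply: contraNneq si => ->; rewrite mevalXU mxE //.
by rewrite !mxE xk // yk // subrr mulr0 addr0.
Qed.

Lemma has_chain_full : has_chain [set x : 'rV[K]_n.+1 | x != 0] n.
Proof.
exists coordinate_flag; split=> k kn.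
  by split; [exact: coordinate_flag_subvariety|move=> x []].
split=> [x [x0 xk]|/(_ (delta_mx 0 (inord k.+1)))].
  by split=> // i /ltnW; apply: xk.
have d1 : (delta_mx 0 (inord k.+1) : 'rV[K]_n.+1) 0 (inord k.+1) = 1.
  by rewrite mxE !eqxx.
case.
  split=> [|i ki]; first by apply/rV0Pn; exists (inord k.+1); rewrite d1 oner_eq0.
  rewrite mxE /=; case: eqP => // iE; move: ki; rewrite iE inordK //.
  by rewrite ltnn.
move=> _ /(_ (inord k.+1)); rewrite inordK // d1 => /(_ (ltnSn _)) /eqP.
by rewrite oner_eq0.
Qed.

Lemma hilbert_function_binomial (V : set 'rV[K]_n.+1) t :
  (hilbert_function V t <= t.+1 ^ n)%N.
Proof.
apply: (@leq_trans 'C(t + n, t)).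
  by apply: leq_trans (leq_subr _ _) _; rewrite dimvf.
rewrite -bin_sub ?leq_addr // addKn; elim: {V}n => [|m IH]; first by rewrite bin0.
rewrite -(leq_pmul2l (ltn0Sn m)) addnS -mul_bin_diag /= expnS mulnA.
by apply: leq_mul IH; lia.
Qed.

End ProjectiveSpace.

(** Noether normalization, one projection at a time: the flag of coordinate
    subspaces of the final projective space lifts to a chain in V. *)
Lemma subvariety_growth (K : closedFieldType) n (V : set 'rV[K]_n.+1) :
  subvariety V -> exists d C, has_chain V d /\
    forall t, (hilbert_function V t <= C * t.+1 ^ d)%N.
Proof.
elim: n V => [|n IH] V sV; have [clV [x Vx] _] := sV;
  have [/existsNP[q /not_implyP[q0 Vq]]|/contrapT allV] :=
    pselect (~ forall q, q != 0 -> V q).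
- have /rV0Pn[i qi] := q0; have /rV0Pn[k xk] := proj_closed_neq0 clV Vx.
  case: Vq; rewrite !ord1 in qi xk.
  have -> : q = (q 0 0 / x 0 0) *: x.
    by apply/rowP => l; rewrite !mxE !ord1 divfK.
  by apply: proj_closedZ; rewrite ?mulf_neq0 ?invr_eq0.
- have -> : V = [set x | x != 0].
    by apply/seteqP; split=> y; [apply: proj_closed_neq0|apply: allV].
  exists 0%N, 1%N; split=> [|t]; first exact: has_chain_full.
  by rewrite mul1n hilbert_function_binomial.
- have /rV0Pn[j qj] := q0; pose p := (q 0 j)^-1 *: q.
  have pj : p 0 j = 1 by rewrite mxE mulVf.
  have pV : ~ V p.
    move=> Vp; apply: Vq.
    have -> : q = q 0 j *: p by rewrite scalerA mulfV // scale1r.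
    exact: proj_closedZ.
  have [d [C [chZ HC]]] := IH _ (proj_image_subvariety pj sV pV).
  have [e He] := hilbert_function_proj pj sV pV.
  exists d, (e * C)%N; split; first exact: has_chain_lift chZ.
  by move=> t; apply: leq_trans (He t) _; rewrite -mulnA leq_mul2l HC orbT.
- have -> : V = [set x | x != 0].
    by apply/seteqP; split=> y; [apply: proj_closed_neq0|apply: allV].
  exists n.+1, 1%N; split=> [|t]; first exact: has_chain_full.
  by rewrite mul1n hilbert_function_binomial.
Qed.

Lemma has_chain_leq (K : fieldType) n (V : set 'rV[K]_n.+1) r s :
  (s <= r)%N -> has_chain V r -> has_chain V s.
Proof.
move=> sr [Z [sZ ltZ]]; exists Z; split=> k ks; first exact/sZ/(leq_trans ks).
exact/ltZ/(leq_trans ks).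
Qed.

(** Chains bound the growth from below and, through projections, the growth
    provides chains; hence the two orders agree. *)
Lemma has_dimP (K : closedFieldType) n (V : set 'rV[K]_n.+1) r : subvariety V ->
  has_dim V r <->
  (exists C, forall t, (hilbert_function V t <= C * t.+1 ^ r)%N) /\
  (exists E, forall t, (t ^ r <= hilbert_function V (E * t))%N).
Proof.
move=> sV; have [d [C [chd HC]]] := subvariety_growth sV.
split=> [[chr maxr]|[[C' HC'] [E HE]]].
  split; last exact: has_chain_growth.
  exists C => t; apply: leq_trans (HC t) _.
  by rewrite leq_mul2l leq_pexp2l ?orbT // maxr.
have rd : (r <= d)%N.
  by apply: (@growth_leq _ _ C E) => t; apply: leq_trans (HE t) (HC _).
split; first exact: has_chain_leq chd.
move=> s /has_chain_growth[E' HE'].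
by apply: (@growth_leq _ _ C' E') => t; apply: leq_trans (HE' t) (HC' _).
Qed.

(** * Products of functions in separate variables *)

Lemma prod_sum_fprod (R : comPzRingType) (I : finType) (T_ : I -> finType)
    (F : forall i, T_ i -> R) :
  \prod_i \sum_j F i j = \sum_(t : fprod T_) \prod_i F i (t i).
Proof.
pose G i := finfun (F i).
under eq_bigr => i _.
  under eq_bigr => k _ do rewrite -[F i k]/(F i k) -(ffunE (F i)) -/(G i).
  rewrite (big_tag G).
  over.
rewrite bigA_distr_big_dep -big_fprod.
by apply: eq_bigr => t _; apply: eq_bigr => i _; rewrite ffunE.
Qed.

(** A relation between the products is, as a function of one variable, a relation
    between the functions of the corresponding factor; its coefficients are again
    relations, in fewer variables. *)
Lemma indep_on_fprod (K : fieldType) (T : Type) l (V : 'I_l -> set T)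
    (J : 'I_l -> finType) (b : forall i, J i -> T -> K) (c : fprod J -> K) :
  (forall i, indep_on (V i) (b i)) ->
  (forall x : 'I_l -> T, (forall i, V i (x i)) ->
     \sum_t c t * \prod_i b i (t i) (x i) = 0) ->
  forall t, c t = 0.
Proof.
move=> bI c0 t0.
(* The first k variables are replaced by fixed values of their indices. *)
suff P k : (k <= l)%N -> forall x : 'I_l -> T, (forall i, V i (x i)) ->
    \sum_(t : fprod J | [forall i : 'I_l, (i < k)%N ==> (t i == t0 i)])
       c t * \prod_(i < l | (k <= i)%N) b i (t i) (x i) = 0.
  have /choice[x Vx] : forall i, exists x, V i x.
    move=> i; apply: contrapT => /forallNP V0.
    have := bI i (fun=> 1); move=> /(_ _ (t0 i)) H.
    by have /eqP := H (fun x Vx => False_ind _ (V0 x Vx)); rewrite oner_eq0.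
  have := P l (leqnn _) x Vx; rewrite (big_pred1 t0) => [|t /=].
    by rewrite big_pred0 ?mulr1 // => i; rewrite leqNgt ltn_ord.
  apply/forallP/eqP => [h|-> i]; last by rewrite eqxx implybT.
  by apply/fprodP => i; have := h i; rewrite ltn_ord => /eqP.
elim: k => [_ x Vx|k IH kl x Vx].
  rewrite -[RHS](c0 x Vx); apply: eq_big => [t|t _]; first by apply/forallP.
  by congr (_ * _); apply: eq_bigl.
pose o := Ordinal kl.
pose c' (a : J o) := \sum_(t : fprod J |
    [forall i : 'I_l, (i < k)%N ==> (t i == t0 i)] && (t o == a))
  c t * \prod_(i < l | (k < i)%N) b i (t i) (x i).
transitivity (c' (t0 o)).
  apply: eq_bigl => t; apply/forallP/andP => [h|[/forallP h /eqP to] i].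
    split; last by have := h o; rewrite /= ltnSn.
    by apply/forallP => i; apply/implyP => ik; have := h i; rewrite (leqW ik).
  rewrite ltnS leq_eqVlt; have [io|/= ni] := eqVneq (i : nat) k; last exact: h.
  by have -> : i = o by [apply: val_inj]; rewrite to eqxx.
apply: (bI o c') => u Vu.
pose x' i := if i == o then u else x i; have x'o : x' o = u by rewrite /x' eqxx.
rewrite -[RHS](IH (ltnW kl) x'); last by move=> i; rewrite /x'; case: eqP => [->|].
rewrite [RHS](partition_big (fun t : fprod J => t o) xpredT) //=.
apply: eq_bigr => a _; rewrite mulr_suml; apply: eq_bigr => t /andP[_ /eqP ta].
rewrite [in RHS](bigD1 o) //= x'o ta mulrA [in RHS]mulrAC; congr (_ * _ * _).
apply: eq_big => [i|i ki]; last first.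
  by rewrite /x'; case: eqP ki => // ->; rewrite ltnn.
by rewrite ltn_neqAle eq_sym andbC.
Qed.

(** * Hadamard products of linear spaces in general position *)

Section Segre.
Variables (l : nat) (h : 'I_l -> nat).

Definition multi_index := fprod (fun i => 'I_(h i).+1 : finType).

Definition index_of (k : 'I_#|{: multi_index}|) : multi_index := enum_val k.

Definition hadamard_row (R : comNzRingType) m (x : 'I_l -> 'rV[R]_m) : 'rV[R]_m :=
  \row_j \prod_(i < l) x i ord0 j.

Definition segre_row (R : comNzRingType) (s : forall i, 'rV[R]_(h i).+1) :
    'rV[R]_#|{: multi_index}| :=
  \row_k \prod_(i < l) s i ord0 (index_of k i).

(** The Hadamard products of the rows of the A i: the linear map whose
    composite with the Segre map is the Hadamard product. *)
Definition hadamard_mx (R : comNzRingType) m (A : forall i, 'M[R]_((h i).+1, m)) :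
    'M[R]_(#|{: multi_index}|, m) :=
  \matrix_(k, j) \prod_(i < l) A i (index_of k i) j.

Lemma prod_mulmxE (R : comNzRingType) m (A : forall i, 'M[R]_((h i).+1, m))
    (s : forall i, 'rV[R]_(h i).+1) (c : 'I_l -> 'I_m) :
  \prod_i (s i *m A i) ord0 (c i) =
  \sum_k segre_row s ord0 k * \prod_(i < l) A i (index_of k i) (c i).
Proof.
under eq_bigr => i _ do rewrite mxE.
rewrite prod_sum_fprod (reindex _ (onW_bij _ (enum_val_bij multi_index))) /=.
by apply: eq_bigr => k _; rewrite mxE big_split.
Qed.

Lemma hadamard_rowE (R : comNzRingType) m (A : forall i, 'M[R]_((h i).+1, m))
    (s : forall i, 'rV[R]_(h i).+1) :
  hadamard_row (fun i => s i *m A i) = segre_row s *m hadamard_mx A.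
Proof.
apply/rowP => j; rewrite !mxE (prod_mulmxE A s (fun=> j)).
by apply: eq_bigr => k _; rewrite [hadamard_mx _ _ _]mxE.
Qed.

End Segre.

Lemma mem_param_space (K : fieldType) n m (A : 'M[K]_(m, n.+1)) x :
  x \in param_space A <-> exists s, x = s *m A.
Proof.
split=> [|[s ->]].
  have -> : param_space A = <<[tuple row k A | k < m]>>%VS by [].
  move=> /coord_span xE.
  exists (\row_k coord [tuple row k A | k < m] k x).
  rewrite {1}xE mulmx_sum_row; apply: eq_bigr => k _.
  by rewrite mxE -tnth_nth tnth_mktuple.
rewrite mulmx_sum_row; apply: memv_suml => k _; apply: memvZ.
by apply: memv_span; apply: map_f; rewrite mem_enum.
Qed.

Section GeneralPosition.
Variables (K : fieldType) (n l : nat) (h : 'I_l -> nat).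
Implicit Types (A : forall i, 'M[K]_((h i).+1, n.+1)).

Definition in_general_position (L : 'I_l -> {vspace 'rV[K]_n.+1}) :=
  exists A, (forall i, L i = param_space (A i)) /\ row_free (hadamard_mx A).

(** The condition does not depend on the bases of the spaces: the rows for one
    choice of bases are combinations of those for any other. *)
Lemma hadamard_mx_row_free A A' :
  (forall i, param_space (A i) = param_space (A' i)) ->
  row_free (hadamard_mx A) -> row_free (hadamard_mx A').
Proof.
move=> eAA'; rewrite /row_free => /eqP rA; rewrite eqn_leq rank_leq_row /=.
rewrite -{1}rA; apply: mxrankS; apply/row_subP => k.
have sP i : exists s, row (index_of k i) (A i) = s *m A' i.
  apply/mem_param_space; rewrite -eAA'; apply/mem_param_space.
  by exists (delta_mx 0 (index_of k i)); rewrite rowE.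
pose s i := sval (cid (sP i)).
have -> : row k (hadamard_mx A) = hadamard_row (fun i => s i *m A' i).
  apply/rowP => j; rewrite !mxE; apply: eq_bigr => i _.
  by rewrite -(svalP (cid (sP i))) mxE.
by rewrite hadamard_rowE submxMl.
Qed.

Definition generic_mx :
    forall i, 'M[{mpoly K[#|{: coef_index n h}|]}]_((h i).+1, n.+1) :=
  fun i => \matrix_(k, j) 'X_(enum_rank (existT _ i (k, j) : coef_index n h)).

Lemma meval_generic_mx A i k j :
  (generic_mx i k j).@[coefs A] = A i k j.
Proof. by rewrite mxE mevalXU /coefs enum_rankK. Qed.

(** If B is a right inverse of the matrix of Hadamard products for one tuple, the
    determinant of the product of this matrix with B is a polynomial in the
    coefficients, it is nonzero for this tuple, and wherever it is nonzero the
    rows are independent. *)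
Lemma general_position_open :
  linear_tuples_open h (fun L => in_general_position L).
Proof.
exists [set p | exists B, forall A, p.@[coefs A] = \det (hadamard_mx A *m B)].
move=> A _; split=> [[A' [eAA' rA']]|[p [B pB]]].
  have /row_freeP[B AB] := hadamard_mx_row_free (fun i => esym (eAA' i)) rA'.
  pose p := \det (hadamard_mx generic_mx *m map_mx (@mpolyC _ K) B).
  have pE A0 : p.@[coefs A0] = \det (hadamard_mx A0 *m B).
    rewrite /p -det_map_mx map_mxM /=; congr (\det (_ *m _)).
      apply/matrixP => k j; rewrite !mxE rmorph_prod; apply: eq_bigr => i _.
      exact: meval_generic_mx.
    by apply/matrixP => k j; rewrite !mxE mevalC.
  by exists p; [exists B|rewrite pE AB det1 oner_eq0].
rewrite pB => dAB; exists A; split=> //.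
have : hadamard_mx A *m B \in unitmx by rewrite unitmxE unitfE.
rewrite -row_free_unit /row_free => /eqP rAB; rewrite eqn_leq rank_leq_row /=.
by rewrite -{1}rAB mxrankM_maxl.
Qed.

(** The column of the A i assigned to a multi-index t consists of the coordinate
    vectors of its components t i; the matrix of Hadamard products then contains
    an identity block. *)
Lemma general_position_nonempty : (\prod_(i < l) (h i).+1 <= n.+1)%N ->
  exists2 L, in_general_position L & forall i, \dim (L i) = (h i).+1.
Proof.
move=> hn; have cardM : #|{: multi_index h}| = (\prod_(i < l) (h i).+1)%N.
  by rewrite card_fprod; apply: eq_bigr => i _; rewrite card_ord.
have le_n k : (k < #|{: multi_index h}| -> k < n.+1)%N.
  by move=> /leq_trans; apply; rewrite cardM.
pose col (t : multi_index h) : 'I_n.+1 := Ordinal (le_n _ (ltn_ord (enum_rank t))).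
pose A i : 'M[K]_((h i).+1, n.+1) :=
  \matrix_(k, j) [exists t, (col t == j) && (t i == k)]%:R.
have col_inj : injective col.
  by move=> t t' /(congr1 val)/= /val_inj/enum_rank_inj.
have AE i k t : A i k (col t) = (t i == k)%:R.
  rewrite mxE; congr (nat_of_bool _)%:R; apply/existsP/eqP => [[t' /andP[]]|<-].
    by move=> /eqP/col_inj -> /eqP.
  by exists t; rewrite !eqxx.
exists (fun i => param_space (A i)).
  exists A; split=> //; apply/row_freeP.
  exists (\matrix_(j, k) (col (enum_val k) == j)%:R).
  apply/matrixP => k k'; rewrite !mxE (bigD1 (col (enum_val k'))) //= big1.
    rewrite !mxE eqxx mulr1 addr0; under eq_bigr => i _ do rewrite AE.
    have [->|nkk'] := eqVneq k k'; first by rewrite big1 // => i _; rewrite eqxx.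
    have [i ni] : exists i, index_of k' i != index_of k i.
      apply: contrapT => /forallNP ekk'; case/eqP: nkk'; apply: enum_val_inj.
      by apply/fprodP => i; apply/esym/eqP/negPn/negP/ekk'.
    by rewrite (bigD1 i) //= (negPf ni) mul0r.
  by move=> j nj; rewrite !mxE eq_sym (negPf nj) mulr0.
move=> i; suff fA : row_free (A i).
  have -> : param_space (A i) = <<[tuple row k (A i) | k < (h i).+1]>>%VS by [].
  have /eqP : free [tuple row k (A i) | k < (h i).+1].
    apply/freeP => c c0; move=> k.
    have : (\row_k c k) *m A i = 0.
      rewrite mulmx_sum_row -[RHS]c0; apply: eq_bigr => k' _.
      by rewrite mxE -tnth_nth tnth_mktuple.
    move/eqP; rewrite mulmx_free_eq0 // => /eqP/rowP/(_ k).
    by rewrite !mxE.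
  by rewrite size_tuple.
apply/row_freeP.
pose t k : multi_index h := fprod_of_fun (fun i' => insubd ord0 (k : nat)).
exists (\matrix_(j, k) (col (t k) == j)%:R).
apply/matrixP => k k'; rewrite !mxE (bigD1 (col (t k'))) //= big1.
  rewrite AE mxE eqxx mulr1 addr0 /t fprodE.
  have -> : insubd ord0 (k' : nat) = k' by apply: val_inj; rewrite val_insubd ltn_ord.
  by rewrite eq_sym.
by move=> j nj; rewrite !mxE eq_sym (negPf nj) mulr0.
Qed.

End GeneralPosition.

Section Pullback.
Variables (K : fieldType) (n l : nat) (h : 'I_l -> nat).
Variable A : forall i, 'M[K]_((h i).+1, n.+1).
Hypothesis freeA : row_free (hadamard_mx A).

Local Notation in_spans x := (forall i : 'I_l, x i \in param_space (A i)).

(** A right inverse of the matrix of Hadamard products recovers the Segre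
    coordinates, hence all products of coordinates, linearly from the Hadamard
    product. *)
Lemma pullback_linear (c : 'I_l -> 'I_n.+1) :
  exists2 q : {mpoly K[n.+1]}, q \is 1.-homog &
  forall x : 'I_l -> 'rV[K]_n.+1, in_spans x ->
    q.@[hadamard_row x ord0] = \prod_i x i ord0 (c i).
Proof.
have /row_freeP[B AB] := freeA.
pose w := \col_k \prod_(i < l) A i (index_of k i) (c i).
exists (\sum_j (B *m w) j ord0 *: 'X_j) => [|x xA].
  by rewrite rpred_sum // => j _; rewrite rpredZ // dhomogX /= mdeg1.
have sP i : exists s, x i = s *m A i by apply/mem_param_space.
pose s i := sval (cid (sP i)).
have -> : x = fun i => s i *m A i.
  by apply/funext => i; exact: svalP (cid (sP i)).
transitivity ((hadamard_row (fun i => s i *m A i) *m (B *m w)) ord0 ord0).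
  rewrite raddf_sum mxE; apply: eq_bigr => j _ /=.
  by rewrite mevalZ mevalXU mulrC.
rewrite hadamard_rowE -mulmxA (mulmxA _ B) AB mul1mx prod_mulmxE mxE.
by apply: eq_bigr => k _; rewrite [w _ _]mxE.
Qed.

Lemma hadamard_row_neq0 (x : 'I_l -> 'rV[K]_n.+1) :
  in_spans x -> (forall i, x i != 0) -> hadamard_row x != 0.
Proof.
move=> xA x0; have /choice[c xc] : forall i, exists j, x i ord0 j != 0.
  by move=> i; apply/rV0Pn.
have [q hq qE] := pullback_linear c.
apply: contraTneq isT => hx0; have := qE x xA.
rewrite hx0 (meval_homog0 hq) => /esym/eqP/prodf_eq0[i _].
by rewrite (negPf (xc i)).
Qed.

(** A product of monomials of degree t splits into t products of one coordinate
    of each factor, and those are linear forms in the Hadamard product. *)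
Lemma pullback_monomial t (m : 'I_l -> 'X_{1..n.+1}) :
  (forall i, mdeg (m i) = t) ->
  exists2 q : {mpoly K[n.+1]}, q \is t.-homog &
  forall x : 'I_l -> 'rV[K]_n.+1, in_spans x ->
    q.@[hadamard_row x ord0] = \prod_i ('X_[m i]).@[x i ord0].
Proof.
elim: t m => [|t IH] m dm.
  exists 1; first exact: dhomog1.
  move=> x _; rewrite meval1 big1 // => i _.
  by have /eqP := dm i; rewrite mdeg_eq0 => /eqP ->; rewrite mpolyX0 meval1.
have /choice[c mc] : forall i, exists j, (0 < m i j)%N.
  move=> i; apply: contrapT => /forallNP m0; have := dm i.
  rewrite mdegE big1 // => j _; apply/eqP; rewrite -leqn0 leqNgt.
  exact/negP/m0.
have mE i : m i = (U_(c i) + (m i - U_(c i)))%MM.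
  rewrite addmC submK //; apply/mnm_lepP => j; rewrite mnm1E.
  by case: eqP => // <-; apply: mc.
have [q1 hq1 q1E] := pullback_linear c.
have [|q hq qE] := IH (fun i => (m i - U_(c i))%MM).
  by move=> i; have := dm i; rewrite {1}mE mdegD mdeg1 => -[].
exists (q1 * q) => [|x xA]; first by rewrite -[t.+1]add1n; apply: dhomogM.
rewrite mevalM q1E // qE // -big_split; apply: eq_bigr => i _ /=.
by rewrite [in RHS]mE mpolyXD mevalM mevalXU.
Qed.

Lemma dhomog_msize_leq t (f : {mpoly K[n.+1]}) :
  f \is t.-homog -> (msize f <= t.+1)%N.
Proof.
move=> /dhomogP hf; rewrite msizeE; apply/bigmax_leqP_seq => m mf _.
by have /= -> := hf m mf.
Qed.

(** The case of monomials extends to all forms by multilinearity. *)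
Lemma pullback_prod t (f : 'I_l -> {mpoly K[n.+1]}) :
  (forall i, f i \is t.-homog) ->
  exists2 q : {mpoly K[n.+1]}, q \is t.-homog &
  forall x : 'I_l -> 'rV[K]_n.+1, in_spans x ->
    q.@[hadamard_row x ord0] = \prod_i (f i).@[x i ord0].
Proof.
move=> hf.
have P (phi : {ffun 'I_l -> 'X_{1..n.+1 < t.+1}}) :
    exists q : {mpoly K[n.+1]}, q \is t.-homog /\
    forall x : 'I_l -> 'rV[K]_n.+1, in_spans x -> q.@[hadamard_row x ord0] =
      \prod_i ((f i)@_(phi i) * ('X_[phi i]).@[x i ord0]).
  have [/forallP dphi|] := boolP [forall i, mdeg (phi i) == t].
    have [|q hq qE] := @pullback_monomial t (fun i => phi i).
      by move=> i; apply/eqP.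
    exists (\prod_i (f i)@_(phi i) *: q); split=> [|x xA]; first by rewrite rpredZ.
    by rewrite mevalZ qE // big_split.
  rewrite negb_forall => /existsP[i di]; exists 0; split=> [|x _].
    exact: rpred0.
  rewrite meval0 (bigD1 i) //= (dhomog_nemf_coeff (hf i)) //.
  by rewrite !mul0r.
have /choice[q qP] := P.
exists (\sum_phi q phi) => [|x xA].
  by rewrite rpred_sum // => phi _; have [] := qP phi.
rewrite raddf_sum /=.
transitivity (\prod_i \sum_(m : 'X_{1..n.+1 < t.+1})
    ((f i)@_m * ('X_[m]).@[x i ord0])).
  by rewrite bigA_distr_bigA /=; apply: eq_bigr => phi _; have [_ ->] := qP phi.
apply: eq_bigr => i _.
rewrite [in RHS](mpolywE (dhomog_msize_leq (hf i))) raddf_sum /=.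
by apply: eq_bigr => m _; rewrite mevalZ.
Qed.

End Pullback.

Section HadamardProduct.
Variables (K : closedFieldType) (n l : nat) (h : 'I_l -> nat).
Variable A : forall i, 'M[K]_((h i).+1, n.+1).
Hypothesis freeA : row_free (hadamard_mx A).
Variable X : 'I_l -> set 'rV[K]_n.+1.
Hypothesis sX : forall i, subvariety (X i).
Hypothesis XA : forall i x, X i x -> x \in param_space (A i).

Definition hadamard_image : set 'rV[K]_n.+1 :=
  [set y : 'rV[K]_n.+1 | y != 0 /\ exists x : 'I_l -> 'rV[K]_n.+1,
     (forall i, X i (x i)) /\ y = hadamard_row x].

Lemma hadamard_image_row x : (forall i, X i (x i)) ->
  hadamard_image (hadamard_row x).
Proof.
move=> Xx; split; last by exists x.
apply: (hadamard_row_neq0 freeA) => i; first exact: XA.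
by have [clX _ _] := sX i; apply: (proj_closed_neq0 clX).
Qed.

Lemma hadamard_product_row x : (forall i, X i (x i)) ->
  hadamard_product X (hadamard_row x).
Proof. by move=> Xx; apply: sub_proj_closure; apply: hadamard_image_row. Qed.

Lemma hadamard_image_neq0 : hadamard_image `<=` [set y | y != 0].
Proof. by move=> y []. Qed.

Lemma vanish_hadamard_product d (q : {mpoly K[n.+1]}) : q \is d.-homog ->
  (forall x, (forall i, X i (x i)) -> q.@[hadamard_row x ord0] = 0) ->
  forall y, hadamard_product X y -> q.@[y ord0] = 0.
Proof.
move=> hq q0; apply: (vanish_closure hadamard_image_neq0 hq).
by move=> _ [_ [x [Xx ->]]]; apply: q0.
Qed.

(** Points x and y of the product of the X i are made to agree in one component
    after the other, keeping two given open conditions. *)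
Lemma hadamard_product_subvariety : subvariety (hadamard_product X).
Proof.
have nonvanish d (q : {mpoly K[n.+1]}) : q \is d.-homog ->
    (exists2 y, hadamard_product X y & q.@[y ord0] != 0) ->
    exists x, (forall i, X i (x i)) /\ q.@[hadamard_row x ord0] != 0.
  move=> hq [y Wy qy]; apply: contrapT => /forallNP nq; case/eqP: qy.
  apply: (vanish_hadamard_product hq) Wy => x Xx.
  by apply/eqP/negPn/negP => qx; apply: (nq x).
apply: prime_subvariety.
- exact: proj_closed_closure hadamard_image_neq0.
- have /choice[x Xx] : forall i, exists x, X i x by move=> i; have [] := sX i.
  by exists (hadamard_row x); apply: hadamard_product_row.
move=> d e f g hf hg /(nonvanish _ _ hf) fW /(nonvanish _ _ hg) gW.
suff P k : (k <= l)%N -> exists x y : 'I_l -> 'rV[K]_n.+1,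
    [/\ forall i, X i (x i), forall i, X i (y i),
        f.@[hadamard_row x ord0] != 0, g.@[hadamard_row y ord0] != 0
      & forall i : 'I_l, (i < k)%N -> x i = y i].
  have [x [y [Xx Xy fx gy xy]]] := P l (leqnn _).
  exists (hadamard_row x); split=> //.
    exact: hadamard_product_row.
  by have -> : x = y by apply/funext => i; apply: xy.
elim: k => [_|k IH kl].
  by have [x [Xx fx]] := fW; have [y [Xy gy]] := gW; exists x, y; split.
have [x [y [Xx Xy fx gy xy]]] := IH (ltnW kl).
pose o := Ordinal kl.
pose upd (z : 'I_l -> 'rV[K]_n.+1) u i := if i == o then u else z i.
pose slice (z : 'I_l -> 'rV[K]_n.+1) (q : {mpoly K[n.+1]}) := q \mPo
  [tuple (\prod_(i < l | i != o) z i ord0 j) *: 'X_j | j < n.+1].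
have sliceE z q (u : 'rV[K]_n.+1) :
    (slice z q).@[u ord0] = q.@[hadamard_row (upd z u) ord0].
  rewrite comp_mpoly_meval; apply: meval_eq => j.
  rewrite tnth_mktuple mevalZ mevalXU mxE [in RHS](bigD1 o) //= {1}/upd eqxx mulrC.
  by congr (_ * _); apply: eq_bigr => i /negPf io; rewrite /upd io.
have slice_homog z q c : q \is c.-homog -> slice z q \is c.-homog.
  move=> hq; apply: dhomog_comp => // j.
  by rewrite tnth_mktuple rpredZ // dhomogX /= mdeg1.
have updK z : upd z (z o) = z.
  by apply/funext => i; rewrite /upd; case: eqP => [->|].
have [||u [Xu fu gu]] := subvariety_prime (sX o) (slice_homog x f _ hf)
  (slice_homog y g _ hg).
- by exists (x o); rewrite // sliceE updK.
- by exists (y o); rewrite // sliceE updK.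
exists (upd x u), (upd y u); split; rewrite -?sliceE //.
- by move=> i; rewrite /upd; case: eqP => [->|].
- by move=> i; rewrite /upd; case: eqP => [->|].
move=> i; rewrite /upd; case: eqP => // io; rewrite ltnS leq_eqVlt.
case/predU1P => [ik|/xy //]; case: io; exact/val_inj.
Qed.

(** A monomial takes at a Hadamard product the product of its values at the
    factors. So the products of basis elements of the factors span the functions
    on the Hadamard product; [pullback_prod] makes them forms of degree t. *)
Lemma hilbert_function_hadamard t : hilbert_function (hadamard_product X) t =
  (\prod_(i < l) hilbert_function (X i) t)%N.
Proof.
pose J i := 'I_(hilbert_function (X i) t) : finType.
pose b i := sval (cid (hilbert_basis (X i) t)).
have bP i : [/\ forall k, b i k \is t.-homog,
    indep_on (X i) (fun (k : J i) x => (b i k).@[x ord0])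
  & forall p, p \is t.-homog ->
      span_on (X i) (fun (k : J i) x => (b i k).@[x ord0]) (fun x => p.@[x ord0])].
  exact: svalP (cid (hilbert_basis (X i) t)).
have hb (tau : fprod J) i : b i (tau i) \is t.-homog by have [] := bP i.
have /choice[q qP] (tau : fprod J) : exists q : {mpoly K[n.+1]},
    q \is t.-homog /\ forall x, (forall i, X i (x i)) ->
    q.@[hadamard_row x ord0] = \prod_i (b i (tau i)).@[x i ord0].
  have [q hq qE] := pullback_prod freeA (hb tau).
  by exists q; split=> // x Xx; apply: qE => i; apply: XA.
have hq tau : q tau \is t.-homog by have [] := qP tau.
have qE tau x : (forall i, X i (x i)) ->
    (q tau).@[hadamard_row x ord0] = \prod_i (b i (tau i)).@[x i ord0].
  by have [_] := qP tau; apply.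
rewrite (hilbert_function_eq hq) => [|c c0|p hp].
- by rewrite card_fprod; apply: eq_bigr => i _; rewrite card_ord.
- have bI i : indep_on (X i) (fun (k : J i) x => (b i k).@[x ord0]).
    by have [] := bP i.
  apply: (indep_on_fprod bI) => x Xx.
  rewrite -[RHS](c0 (hadamard_row x)); last first.
    exact: hadamard_product_row.
  by apply: eq_bigr => tau _; rewrite qE.
suff [c cE] : span_on hadamard_image (fun tau y => (q tau).@[y ord0])
    (fun y => p.@[y ord0]).
  exists c => y Wy; apply/eqP; rewrite -subr_eq0; apply/eqP.
  pose r := p - \sum_tau c tau *: q tau.
  have rE z : r.@[z ord0] = p.@[z ord0] - \sum_tau c tau * (q tau).@[z ord0].
    rewrite /r mevalB (raddf_sum (meval _)) /=; congr (_ - _).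
    by apply: eq_bigr => tau _; rewrite mevalZ.
  have hr : r \is t.-homog.
    by rewrite rpredB // rpred_sum // => tau _; apply: rpredZ; apply: hq.
  rewrite -rE; apply: (vanish_hadamard_product hr) Wy.
  by move=> x Xx; rewrite rE cE ?subrr //; apply: hadamard_image_row.
apply: (@span_on_sum _ _ hadamard_image _ (fun tau y => (q tau).@[y ord0])
  'X_{1..n.+1 < t.+1} (fun=> 1)
  (fun m y => p@_m * ('X_[m] : {mpoly K[n.+1]}).@[y ord0])) => [m|y _]; last first.
  rewrite {1}(mpolywE (dhomog_msize_leq hp)) raddf_sum /=.
  by apply: eq_bigr => m _; rewrite mul1r mevalZ.
have [dm|dm] := eqVneq (mdeg m) t; last first.
  exists (fun=> 0) => y _; rewrite (dhomog_nemf_coeff hp dm) mul0r big1 // => i _.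
  by rewrite mul0r.
have mP i : span_on (X i) (fun (k : J i) x => (b i k).@[x ord0])
    (fun x => ('X_[m] : {mpoly K[n.+1]}).@[x ord0]).
  by have [_ _] := bP i; apply; rewrite dhomogX /= dm.
pose a i := sval (cid (mP i)).
exists (fun tau : fprod J => p@_m * \prod_i a i (tau i)) => _ [_ [x [Xx ->]]].
under eq_bigr => tau _ do rewrite qE // -mulrA -big_split.
rewrite -mulr_sumr -(prod_sum_fprod
  (fun i (k : J i) => a i k * (b i k).@[x i ord0])); congr (_ * _).
have -> : ('X_[m]).@[hadamard_row x ord0] = \prod_i ('X_[m]).@[x i ord0].
  rewrite mevalX; under [RHS]eq_bigr => i _ do rewrite mevalX.
  by rewrite exchange_big; apply: eq_bigr => j _; rewrite mxE prodrXl.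
by apply: eq_bigr => i _; rewrite (svalP (cid (mP i)) _ (Xx i)).
Qed.

End HadamardProduct.

(** * Dimension and degree of Hadamard products *)

Lemma prod_factE (I : finType) (r : I -> nat) :
  (((\sum_i r i)`! %/ \prod_i (r i)`!) * \prod_i (r i)`! = (\sum_i r i)`!)%N.
Proof.
apply: divnK; elim/big_rec2: _ => [|i s P _ IH]; first exact: dvdn1.
rewrite -(bin_fact (leq_addr s (r i))) addKn.
by rewrite dvdn_mull // dvdn_mul.
Qed.

Lemma has_dim_inj (K : fieldType) n (V : set 'rV[K]_n.+1) r s :
  has_dim V r -> has_dim V s -> r = s.
Proof.
move=> [chr maxr] [chs maxs]; apply/eqP.
by rewrite eqn_leq maxr // maxs.
Qed.

Theorem corollary2p7 (K : closedFieldType) (charK0 : [pchar K] =i pred0)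
  (n l : nat) (l_gt0 : (0 < l)%N) (h : 'I_l -> nat)
  (n_ge : (\prod_(i < l) (h i).+1 - 1 <= n)%N) :
  for_generic_linear_tuples h (fun L : 'I_l -> {vspace 'rV[K]_n.+1} =>
    forall (X : 'I_l -> set 'rV[K]_n.+1) (r : 'I_l -> nat),
      (forall i, subvariety (X i)) ->
      (forall i, has_dim (X i) (r i)) ->
      (forall i, is_linear_span (X i) (L i)) ->
      [/\ has_dim (hadamard_product X) (\sum_(i < l) r i)%N,
          forall d : 'I_l -> nat, (forall i, has_degree (X i) (d i)) ->
            has_degree (hadamard_product X)
              (multinomial_coef r * \prod_(i < l) d i)%N
        & forall t, hilbert_function (hadamard_product X) t =
            (\prod_(i < l) hilbert_function (X i) t)%N]).
Proof.
exists (@in_general_position K n l h); split.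
- exact: general_position_open.
- apply: general_position_nonempty; move: n_ge.
  by rewrite leq_subLR add1n.
move=> L _ [A [LA freeA]] X r sX dX spanX.
have XA i x : X i x -> x \in param_space (A i).
  by rewrite -LA; have [+ _] := spanX i; apply.
have HF := hilbert_function_hadamard freeA sX XA.
have sW := hadamard_product_subvariety freeA sX XA.
have dimW : has_dim (hadamard_product X) (\sum_i r i)%N.
  have growth i := (has_dimP _ (sX i)).1 (dX i).
  apply/(has_dimP _ sW); split.
    have /choice[C HC] : forall i, exists C, forall t,
        (hilbert_function (X i) t <= C * t.+1 ^ r i)%N.
      by move=> i; have [] := growth i.
    exists (\prod_i C i)%N => t; rewrite HF expn_sum -big_split /=.
    by apply: leq_prod => i _; apply: HC.
  have /choice[E HE] : forall i, exists E, forall t,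
      (t ^ r i <= hilbert_function (X i) (E * t))%N.
    by move=> i; have [] := growth i.
  exists (\sum_i E i)%N => t; rewrite HF expn_sum; apply: leq_prod => i _.
  apply: leq_trans (HE i t) (hilbert_function_mono (sX i) _).
  by rewrite leq_mul2r (bigD1 i) //= leq_addr orbT.
split=> // d degX.
have /choice[P PX] : forall i, exists P : {poly rat},
    is_hilbert_polynomial (X i) P /\ (d i)%:R = (r i)`!%:R * lead_coef P.
  move=> i; have [r' [P [dX' hP dP]]] := degX i.
  by exists P; rewrite (has_dim_inj (dX i) dX').
exists (\sum_i r i)%N, (\prod_i P i); split=> //.
  have /choice[t0 Ht0] : forall i, exists t0, forall t, (t0 <= t)%N ->
      (P i).[t%:R] = (hilbert_function (X i) t)%:R.
    by move=> i; have [] := PX i.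
  exists (\sum_i t0 i)%N => t t0t; rewrite horner_prod HF natr_prod.
  apply: eq_bigr => i _; apply: Ht0; apply: leq_trans t0t.
  by rewrite (bigD1 i) //= leq_addr.
rewrite lead_coef_prod -(prod_factE r) !natrM !natr_prod -mulrA -big_split /=.
congr (_ * _); apply: eq_bigr => i _.
by have [_ ->] := PX i.
Qed.
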